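(* For any integers $k \geq 1$, $d \geq 2$, and any subgroup $D \leq \mathrm{Sym}(d)$, the Dehn function of $\mathrm{AAut}_{D}(\mathcal{T}_{d,k})$ is asymptotically bounded by the Dehn function of the Higman-Thompson group $V_{d,k}$, i.e. $\delta_{\mathrm{AAut}_{D}(\mathcal{T}_{d,k})} \preccurlyeq \delta_{V_{d,k}}$.
   Context: Trees. Let $A,B$ be finite sets with $|A|=k\ge 1$, $|B|=d\ge 2$. $\mathcal{T}_{d,k}$ is the rooted tree whose vertices are the empty word (the root) and the finite words $ab_1\cdots b_n$ ($n\geq 0$, $a\in A$, $b_i\in B$), with $v$ and $vx$ adjacent; so the root has $k$ children and every other vertex has $d$ children. $\mathcal{T}_d=\mathcal{T}_{d,d}$. For a vertex $v$, $\mathcal{T}_{d,k}^v$ is the subtree of vertices having $v$ as a prefix; for $v\neq$ root it is identified with $\mathcal{T}_d$ using fixed orderings of $A$ and $B$, which order the children of every vertex and induce the lexicographic total order on the boundary $\partial_\infty\mathcal{T}_{d,k}$ (infinite rays from the root, with the usual Cantor topology). $\mathrm{Aut}(\mathcal{T}_{d,k})$ is the group of root-fixing automorphisms. Almost automorphisms. A finite subtree $T$ of $\mathcal{T}_{d,k}$ is a rooted complete subtree if it contains the root as a vertex of degree $k$ and every other vertex of $T$ which is not a leaf has degree $d+1$ in $T$. The complement $\mathcal{T}_{d,k}\setminus T$ is regarded as the forest of the subtrees $\mathcal{T}_{d,k}^v$, $v$ a leaf of $T$. $\mathrm{AAut}(\mathcal{T}_{d,k})$ is the group of homeomorphisms of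 $\partial_\infty\mathcal{T}_{d,k}$ induced by triples $(\psi,T,T')$, where $T,T'$ are finite rooted complete subtrees with the same number of leaves and $\psi:\mathcal{T}_{d,k}\setminus T\to\mathcal{T}_{d,k}\setminus T'$ is a forest isomorphism (mapping components bijectively onto components, by rooted tree isomorphisms). $V_{d,k}$ is the subgroup of elements represented by a triple $(\psi,T,T')$ such that $\psi$ preserves the order of the boundary on each component. It is a finitely presented (discrete) group. The groups $W(D)$, $W_k(D)$, $\mathrm{AAut}_D$. For $D\leq \mathrm{Sym}(d)$, let $D_1=D$, viewed as the subgroup of $\mathrm{Aut}(\mathcal{T}_d)$ permuting the subtrees hanging at level one, and $D_{n+1}=D\wr D_n$ (for the action of $D_n$ on the level $n$ vertices of $\mathcal{T}_d$); i.e. $D_n$ consists of the automorphisms whose local permutation is in $D$ at vertices of level $<n$ and trivial at vertices of level $\geq n$. $W(D)$ is the closed subgroup of $\mathrm{Aut}(\mathcal{T}_d)$ generated by all $D_n$. $W_k(D)\leq\mathrm{Aut}(\mathcal{T}_{d,k})$ is the subgroup fixing level one pointwise and acting by an element of $W(D)$ on each subtree rooted at level one. $\mathrm{AAut}_D(\mathcal{T}_{d,k})$ is the subgroup of $\mathrm{AAut}(\mathcal{T}_{d,k})$ of elements represented by a triple $(\psi,T,T')$ with $\psi$ acting by an element of $W(D)$ on each component. $W_k(D)$ carries its profinite topology (pointwise level stabilizers form a basis of neighbourhoods of $1$), and $\mathrm{AAut}_D(\mathcal{T}_{d,k})$ carries the unique group topology making the inclusion of $W_k(D)$ continuous and open;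 it is locally compact, and it is compactly presented. Dehn functions. A locally compact group $G$ is compactly presented if it has a compact generating subset $S$ and a presentation, as an abstract group, with generating set $S$ and relators of bounded length. Then for some $m$, $G=\langle S\mid R_m\rangle$ with $R_m$ the set of relations of length at most $m$; the area $a(w)$ of a word $w$ in $S$ representing $1$ is the least number of conjugates of relators of $R_m$ (and their inverses) whose product equals $w$ in the free group $F_S$, and $\delta_G(n)=\sup\{a(w): w \text{ a relation of length at most } n\}$. For $f,g:\mathbb{N}\to\mathbb{N}$, $f\preccurlyeq g$ means that there is a constant $c$ with $f(n)\leq c\,g(cn)+cn+c$ for all $n\ge 0$; $f\approx g$ means $f\preccurlyeq g$ and $g\preccurlyeq f$. The $\approx$-class of $\delta_G$ does not depend on $S$ and $m$. *)

(* Defs.v *)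
From HB Require Import structures.
From mathcomp Require Import all_boot all_order all_fingroup finmap.
From mathcomp Require Import all_classical topology.

Set Implicit Arguments.
Unset Strict Implicit.
Unset Printing Implicit Defensive.

Local Open Scope classical_set_scope.
Local Open Scope group_scope.

(** * The group of bijections of a type *)

Record bij (T : Type) := Bij {
  bij_fun :> T -> T;
  bij_inv : T -> T;
  bij_funK : cancel bij_fun bij_inv;
  bij_invK : cancel bij_inv bij_fun }.

Lemma bij_eq T (f g : bij T) : f =1 g -> f = g.
Proof.
move=> fg; have e1 : bij_fun f = bij_fun g by apply/funext.
have e2 : bij_inv f = bij_inv g.
  by apply/funext => x; apply: (can_inj (bij_funK f)); rewrite bij_invK fg bij_invK.
case: f g {fg} e1 e2 => [f f' fK f'K] [g g' gK g'K] /= e1 e2.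
by subst g g'; congr Bij; exact: Prop_irrelevance.
Qed.

Section BijGroup.
Variable T : Type.
Implicit Types f g h : bij T.

Definition bij_one : bij T := @Bij T id id (frefl _) (frefl _).
Definition bij_opp f : bij T := Bij (bij_invK f) (bij_funK f).
Definition bij_mul f g : bij T :=
  @Bij T (f \o g) (bij_inv g \o bij_inv f)
    (can_comp (bij_funK f) (bij_funK g)) (can_comp (bij_invK g) (bij_invK f)).

Lemma bij_mulA : associative bij_mul. Proof. by move=> f g h; exact: bij_eq. Qed.
Lemma bij_mul1 : left_id bij_one bij_mul. Proof. by move=> f; exact: bij_eq. Qed.
Lemma bij_mulr1 : right_id bij_one bij_mul.
Proof. by move=> f; exact: bij_eq. Qed.
Lemma bij_mulV : left_inverse bij_one bij_opp bij_mul.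
Proof. by move=> f; apply: bij_eq => x /=; rewrite bij_funK. Qed.
Lemma bij_mulrV : right_inverse bij_one bij_opp bij_mul.
Proof. by move=> f; apply: bij_eq => x /=; rewrite bij_invK. Qed.

HB.instance Definition _ := gen_eqMixin (bij T).
HB.instance Definition _ := gen_choiceMixin (bij T).
HB.instance Definition _ := isGroup.Build (bij T)
  bij_mulA bij_mul1 bij_mulr1 bij_mulV bij_mulrV.

End BijGroup.

Definition subgroup (gT : groupType) (H : set gT) : Prop :=
  [/\ H 1, forall f g, H f -> H g -> H (f * g) & forall f, H f -> H f^-1].

(** * Areas and Dehn functions *)

(* A topological group is given here as a topological space [T] together with
   an injection [i] of [T] onto a subgroup of a group [gT]. *)

Section Words.
Variable X : Type.

(* The letter [(x, true)] stands for the formal inverse of [x]. *)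
Definition word := seq (X * bool).

Definition word_inv (w : word) : word := rev [seq (x.1, ~~ x.2) | x <- w].

(* Two words are [free_eq] iff they are equal in the free group on [X]. *)
Inductive free_eq : word -> word -> Prop :=
| free_refl w : free_eq w w
| free_sym v w : free_eq v w -> free_eq w v
| free_trans u v w : free_eq u v -> free_eq v w -> free_eq u w
| free_cancel u v x b : free_eq (u ++ (x, b) :: (x, ~~ b) :: v) (u ++ v).

End Words.

Section Area.
Variables (gT : groupType) (T : Type) (i : T -> gT) (S : set T) (m : nat).
Implicit Types (w r : word S) (n a N : nat).

Definition word_eval w : gT :=
  \big[*%g/1]_(x <- w) (if x.2 then (i (val x.1))^-1 else i (val x.1)).

Definition relation_le n r : Prop := (size r <= n)%N /\ word_eval r = 1.

Definition filling w N : Prop :=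
  exists (u r : 'I_N -> word S) (b : 'I_N -> bool),
    (forall j, relation_le m (r j)) /\
    free_eq w (\big[cat/[::]]_(j < N)
      (u j ++ (if b j then word_inv (r j) else r j) ++ word_inv (u j))).

Definition area w a : Prop :=
  filling w a /\ forall N, filling w N -> (a <= N)%N.

(* The image of [i] is the group <S | R_m>. *)
Definition presented : Prop :=
  range word_eval = range i /\
  forall w, word_eval w = 1 -> exists N, filling w N.

Definition areas n : set nat :=
  [set a | exists w, relation_le n w /\ area w a].

End Area.

(* [delta] is the (everywhere finite) Dehn function attached to some compact
   generating subset and some bound on the length of the relators. *)
Definition is_dehn_function (gT : groupType) (T : topologicalType)
    (i : T -> gT) (delta : nat -> nat) : Prop :=
  exists (S : set T) (m : nat),
    [/\ compact S, presented i S m &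
        forall n, supremums (areas i S m n) (delta n)].

Definition asymp_le (f g : nat -> nat) : Prop :=
  exists c : nat, forall n, (f n <= c * g (c * n) + c * n + c)%N.

(** * Automorphisms of the regular rooted tree *)

(* The vertices of the d-regular rooted tree are the words on ['I_d]. *)

Section RegularTree.
Variable d : nat.
Implicit Types (u v : seq 'I_d) (f g : bij (seq 'I_d)).

Definition adjacent u v : Prop :=
  exists x, v = rcons u x \/ u = rcons v x.

Definition tree_aut : set (bij (seq 'I_d)) :=
  [set g : bij (seq 'I_d) | g [::] = [::] /\
           forall u v, adjacent u v <-> adjacent (g u) (g v)].

(* Closedness in [tree_aut] for the topology of pointwise convergence. *)
Definition aut_closed (H : set (bij (seq 'I_d))) : Prop :=
  forall g, tree_aut g ->
    (forall n, exists h, H h /\ forall v, (size v <= n)%N -> h v = g v) -> H g.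

(* [s v] is the local permutation of [g] at the vertex [v]. *)
Definition iterated_wreath (D : {group 'S_d}) (n : nat) :
    set (bij (seq 'I_d)) :=
  [set g : bij (seq 'I_d) | g [::] = [::] /\
    exists s : seq 'I_d -> 'S_d, forall v,
      [/\ forall x, g (rcons v x) = rcons (g v) (s v x),
          (size v < n)%N -> s v \in D &
          (n <= size v)%N -> s v = 1]].

Definition W (D : {group 'S_d}) : set (bij (seq 'I_d)) :=
  \bigcap_(H in [set H | [/\ H `<=` tree_aut, subgroup H, aut_closed H &
      forall n, (0 < n)%N -> iterated_wreath D n `<=` H]]) H.

Definition ray := nat -> 'I_d.

(* If [g] is an automorphism, then [g (mkseq xi n)] is the prefix of length [n]
   of [ray_act g xi]. *)
Definition ray_act g (xi : ray) : ray :=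
  fun n => last (xi n) (g (mkseq xi n.+1)).

Definition ray_cat u (xi : ray) : ray :=
  fun n => nth (xi (n - size u)%N) u n.

End RegularTree.

(** * Almost automorphisms *)

Section AlmostAutomorphisms.
Variables k d : nat.

(* The word a b_1 ... b_n is encoded as [(a, [:: b_1; ...; b_n])]; the root of
   the tree, that is the empty word, has no encoding. *)
Definition vertex : Type := ('I_k * seq 'I_d)%type.

Definition boundary : Type := ('I_k * ray d)%type.

Implicit Types (p : vertex) (xi eta : ray d) (T : {fset 'I_k * seq 'I_d}).

Definition bd_cat p xi : boundary := (p.1, ray_cat p.2 xi).

Definition bd_lt (x y : boundary) : Prop :=
  (x.1 < y.1)%N \/
  x.1 = y.1 /\ exists n, (forall j, (j < n)%N -> x.2 j = y.2 j) /\
                         (x.2 n < y.2 n)%N.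

(* [T] is the set of vertices, other than the root, of a finite rooted complete
   subtree. *)
Definition complete_subtree T : Prop :=
  [/\ forall a, (a, [::]) \in T,
      forall a v x, (a, rcons v x) \in T -> (a, v) \in T &
      forall a v x y, (a, rcons v x) \in T -> (a, rcons v y) \in T].

Definition leaf T : set vertex :=
  [set p | p \in T /\ forall x, (p.1, rcons p.2 x) \notin T].

(* The forest isomorphism sends the component at the leaf [p] of [T] onto the
   component at the leaf [sigma p] of [T'], acting by [phi p] once both are
   identified with the d-regular rooted tree; [f] is the induced map. *)
Definition represents T T' (sigma : vertex -> vertex)
    (phi : vertex -> bij (seq 'I_d)) (f : bij boundary) : Prop :=
  [/\ complete_subtree T, complete_subtree T',
      set_bij (leaf T) (leaf T') sigma,
      forall p, leaf T p -> tree_aut (phi p) &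
      forall p xi, leaf T p ->
        f (bd_cat p xi) = bd_cat (sigma p) (ray_act (phi p) xi)].

Definition HT : set (bij boundary) :=
  [set f : bij boundary | exists T T' sigma phi, represents T T' sigma phi f /\
    forall p xi eta, leaf T p -> bd_lt (bd_cat p xi) (bd_cat p eta) ->
      bd_lt (f (bd_cat p xi)) (f (bd_cat p eta))].

Definition AAutD (D : {group 'S_d}) : set (bij boundary) :=
  [set f : bij boundary | exists T T' sigma phi, represents T T' sigma phi f /\
    forall p, leaf T p -> W D (phi p)].

Definition Wk (D : {group 'S_d}) : set (bij boundary) :=
  [set f : bij boundary | exists w : 'I_k -> bij (seq 'I_d),
    (forall a, W D (w a)) /\ forall a xi, f (a, xi) = (a, ray_act (w a) xi)].

(* The pointwise stabilizer in [Wk D] of the vertices [(a, v)] with [v] of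
   length at most [n], expressed by the action on the boundaries of the subtrees
   rooted at these vertices. *)
Definition Wk_stab (D : {group 'S_d}) (n : nat) : set (bij boundary) :=
  Wk D `&` [set f : bij boundary | forall a v xi, (size v <= n)%N ->
    exists eta, f (bd_cat (a, v) xi) = bd_cat (a, v) eta].

End AlmostAutomorphisms.

(** * The groups as topological spaces *)

Definition V_group (k d : nat) : Type := discrete_topology (@HT k d).
HB.instance Definition _ k d := Topological.on (V_group k d).

Definition V_val k d (x : V_group k d) : bij (boundary k d) := sval x.

Definition AAutD_group (k d : nat) (D : {group 'S_d}) : Type := @AAutD k d D.
HB.instance Definition _ k d D := Choice.on (@AAutD_group k d D).

Definition AAutD_val k d (D : {group 'S_d}) (x : AAutD_group k D) :
  bij (boundary k d) := sval x.

Section AAutDTopology.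
Variables (k d : nat) (D : {group 'S_d}).
Local Notation G := (AAutD_group k D).

(* The left translates g W_n of the level stabilizers form a base: this is what
   a group topology for which [Wk D], with its profinite topology, is an open
   subgroup has to be. *)
Definition AAutD_open (U : set G) : Prop :=
  forall x, U x -> exists n, forall y : G,
    Wk_stab D n ((AAutD_val x)^-1 * AAutD_val y) -> U y.

Lemma AAutD_openT : AAutD_open setT.
Proof. by move=> x _; exists 0%N. Qed.

Lemma AAutD_openI : setI_closed AAutD_open.
Proof.
have stab_le n n' f : (n <= n')%N -> @Wk_stab k d D n' f -> Wk_stab D n f.
  move=> le_n [Wf fixf]; split=> // a v xi v_le.
  by apply: fixf; exact: leq_trans v_le le_n.
move=> A B oA oB x [/oA[n An] /oB[n' Bn']]; exists (maxn n n') => y xy.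
split; [apply: An|apply: Bn']; apply: stab_le xy.
- exact: leq_maxl.
- exact: leq_maxr.
Qed.

Lemma AAutD_open_bigU (I : Type) (F : I -> set G) :
  (forall j, AAutD_open (F j)) -> AAutD_open (\bigcup_j F j).
Proof.
move=> oF x [j _ /oF[n Fn]]; exists n => y /Fn Fy; by exists j.
Qed.

HB.instance Definition _ :=
  isOpenTopological.Build G AAutD_openT AAutD_openI AAutD_open_bigU.

End AAutDTopology.

(* Main.v *)
From mathcomp Require Import all_boot all_order all_fingroup finmap zify.
From mathcomp Require Import all_classical topology.
Require Import Defs.

(* Let K = W_k(D), a compact open subgroup of G = AAut_D, and V = V_{d,k}; then
   G = V K. Since K s K is a finite union of cosets v K with v in V, pushing the
   factors in K to the right turns a word of length n in a compact generating
   set of G, at linear cost, into v_1 ... v_n g with g in K and all v_i in a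
   finite subset of V. If the word is a relation, g lies in V, and the number of
   vertices at which the section of g is nontrivial is at most linear in n: the
   number of vertices at which an element of V is not a mere prefix replacement
   is subadditive. Traversing the tree formed by these vertices in depth-first
   order writes g as a word of linear length in generators of V, at linear cost
   because each step only uses relations of bounded length between elements of
   K and of a finite subset of V. What remains is a relation of V of linear
   length. That K has bounded length with respect to any compact generating set
   is a Baire category argument. *)

Set Implicit Arguments.
Unset Strict Implicit.
Unset Printing Implicit Defensive.

Local Open Scope classical_set_scope.
Local Open Scope group_scope.

(** * Words and fillings *)

(** Depth is the wrong measure for g: it is at most linear in n as well, but a tree of linear depth
    can have exponentially many vertices. Hence the count of bad vertices. Even so, carrying each
    nontrivial section separately to a fixed place would use conjugators as long as the depth and
    give only a quadratic bound. In the traversal every section is brought back to one fixed cone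
    [c] before its children are treated, by one of finitely many elements of V, so the cost of a
    step does not depend on the depth. Every step exchanges boundedly many words [rho f] with f in K
    or in a finite part of V; these have bounded length, so the step costs the Dehn function of G at
    a constant. Both generating sets are arbitrary: no letter of S is assumed to lie in K or V, and
    V enters only by rewriting its generators as words in S, which turns its relators into relations
    of bounded length. This is why the Dehn function of V ends up multiplied by a constant. *)

Section FreeWords.
Variable X : Type.
Implicit Types (u v w : word X).

Lemma word_inv_cat u v : word_inv (u ++ v) = word_inv v ++ word_inv u.
Proof. by rewrite /word_inv map_cat rev_cat. Qed.

Lemma word_invK : involutive (@word_inv X).
Proof.
move=> w; rewrite /word_inv map_rev revK -map_comp -[RHS]map_id.
by apply: eq_map => -[x b] /=; rewrite negbK.
Qed.

Lemma size_word_inv w : size (word_inv w) = size w.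
Proof. by rewrite size_rev size_map. Qed.

Lemma free_eq_ctx a b u v : free_eq u v -> free_eq (a ++ u ++ b) (a ++ v ++ b).
Proof.
elim=> {u v} [w|v w _|u v w _ IH1 _ IH2|u v x c].
- exact: free_refl.
- exact: free_sym.
- exact: free_trans IH1 IH2.
- have := free_cancel (a ++ u) (v ++ b) x c; by rewrite -!catA.
Qed.

Lemma free_eq_cat u u' v v' :
  free_eq u u' -> free_eq v v' -> free_eq (u ++ v) (u' ++ v').
Proof.
move=> /(free_eq_ctx [::] v) e1 /(free_eq_ctx u' [::]) e2.
by apply: free_trans e1 _; move: e2; rewrite !cats0.
Qed.

Lemma free_eqV w : free_eq (w ++ word_inv w) [::].
Proof.
elim: w => [|[x b] w IH]; first exact: free_refl.
rewrite -cat1s word_inv_cat.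
have := free_eq_ctx [:: (x, b)] (word_inv [:: (x, b)]) IH.
rewrite catA /= => e; apply: free_trans; first by move: e; rewrite -catA; exact.
exact: (free_cancel [::] [::]).
Qed.

Lemma free_eqVl w : free_eq (word_inv w ++ w) [::].
Proof. by have := free_eqV (word_inv w); rewrite word_invK. Qed.

Lemma free_eq_inv u v : free_eq u v -> free_eq (word_inv u) (word_inv v).
Proof.
elim=> {u v} [w|v w _|u v w _ IH1 _ IH2|u v x c].
- exact: free_refl.
- exact: free_sym.
- exact: free_trans IH1 IH2.
- rewrite !word_inv_cat -cat1s -[_ :: v]cat1s !word_inv_cat -!catA.
  by rewrite /word_inv /= negbK; exact: free_cancel.
Qed.

End FreeWords.

Section Fillings.
Variables (gT : groupType) (T : Type) (i : T -> gT) (S : set T) (m : nat).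
Implicit Types (u v w r : word S) (N : nat).

Local Notation ev := (@word_eval gT T i S).
Local Notation filling := (@filling gT T i S m).

Lemma word_eval_nil : ev [::] = 1.
Proof. by rewrite /word_eval big_nil. Qed.

Lemma word_eval_cat u v : ev (u ++ v) = ev u * ev v.
Proof. by rewrite /word_eval big_cat. Qed.

Lemma word_eval_inv w : ev (word_inv w) = (ev w)^-1.
Proof.
elim: w => [|[x b] w IH]; first by rewrite /word_inv /= word_eval_nil invg1.
rewrite -cat1s word_inv_cat !word_eval_cat IH invgM; congr (_ * _).
by rewrite /word_eval /= !big_seq1 /=; case: b => //; rewrite invgK.
Qed.

Lemma filling0 w : free_eq w [::] -> filling w 0.
Proof.
move=> w1; exists (fun _ => [::]), (fun _ => [::]), (fun _ => false).
by split=> [[]//|]; rewrite big_ord0.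
Qed.

Lemma filling_rel r : relation_le i m r -> filling r 1.
Proof.
move=> rP; exists (fun _ => [::]), (fun _ => r), (fun _ => false).
by split=> // ; rewrite big_ord1 /= /word_inv cats0; exact: free_refl.
Qed.

Lemma filling_free_eq v w N : free_eq v w -> filling w N -> filling v N.
Proof.
move=> vw [u [r [b [rP wE]]]]; exists u, r, b; split=> //.
exact: free_trans vw wE.
Qed.

Lemma filling_cat v w N M :
  filling v N -> filling w M -> filling (v ++ w) (N + M).
Proof.
move=> [u [r [b [rP vE]]]] [u' [r' [b' [rP' wE]]]].
exists (fun j => match fintype.split j with inl a => u a | inr a => u' a end).
exists (fun j => match fintype.split j with inl a => r a | inr a => r' a end).
exists (fun j => match fintype.split j with inl a => b a | inr a => b' a end).
split=> [j|]; first by case: fintype.split.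
rewrite big_split_ord /=; apply: free_eq_cat.
  apply: free_trans vE _; under [X in free_eq _ X]eq_bigr => j _.
    have -> : fintype.split (lshift M j) = inl j by exact: (unsplitK (inl _)).
    over.
  exact: free_refl.
apply: free_trans wE _; under [X in free_eq _ X]eq_bigr => j _.
  have -> : fintype.split (rshift N j) = inr j by exact: (unsplitK (inr _)).
  over.
exact: free_refl.
Qed.

(** [filling] asks for exactly [N] conjugates; the empty word is a relator for every [m], so a
    filling can be padded. *)
Lemma filling_leq w N M : (N <= M)%N -> filling w N -> filling w M.
Proof.
move=> /subnKC <-; elim: (M - N)%N => [|k IH]; first by rewrite addn0.
move=> /IH wk; rewrite addnS -addn1 -[w]cats0; apply: filling_cat => //.
by apply: filling_rel; split=> //; rewrite word_eval_nil.
Qed.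

Lemma free_eq_bigcat N (F F' : 'I_N -> word S) :
  (forall j, free_eq (F j) (F' j)) ->
  free_eq (\big[cat/[::]]_(j < N) F j) (\big[cat/[::]]_(j < N) F' j).
Proof.
move=> FF'; apply: (big_ind2 (@free_eq S)) => //; first exact: free_refl.
by move=> *; exact: free_eq_cat.
Qed.

Lemma conj_bigcat N (F : 'I_N -> word S) v :
  free_eq (v ++ (\big[cat/[::]]_(j < N) F j) ++ word_inv v)
    (\big[cat/[::]]_(j < N) (v ++ F j ++ word_inv v)).
Proof.
elim: N F => [|N IH] F; first by rewrite !big_ord0 /=; exact: free_eqV.
rewrite !big_ord_recl.
apply: free_trans; last first.
  by apply: free_eq_cat; [exact: free_refl|exact: IH].
apply: free_sym; rewrite -!catA; set B := \big[_/_]_(_ < N) _.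
have := free_eq_ctx (v ++ F ord0) (B ++ word_inv v) (free_eqVl v).
by rewrite -!catA.
Qed.

Lemma filling_conj v w N : filling w N -> filling (v ++ w ++ word_inv v) N.
Proof.
move=> [u [r [b [rP wE]]]]; exists (fun j => v ++ u j), r, b; split=> //.
apply: free_trans (free_eq_ctx v (word_inv v) wE) _.
apply: free_trans; first exact: conj_bigcat.
by apply: free_eq_bigcat => j; rewrite word_inv_cat -!catA; exact: free_refl.
Qed.

Lemma word_inv_bigcat N (F : 'I_N -> word S) :
  word_inv (\big[cat/[::]]_(j < N) F j) =
  \big[cat/[::]]_(j < N) word_inv (F (rev_ord j)).
Proof.
elim: N F => [|N IH] F; first by rewrite !big_ord0.
rewrite big_ord_recl big_ord_recr word_inv_cat IH; congr (_ ++ word_inv (F _)).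
  apply: eq_bigr => j _; congr (word_inv (F _)); apply: val_inj.
  have := ltn_ord j; rewrite /= /bump; lia.
by apply: val_inj => /=; lia.
Qed.

Lemma filling_inv w N : filling w N -> filling (word_inv w) N.
Proof.
move=> [u [r [b [rP wE]]]].
exists (fun j => u (rev_ord j)), (fun j => r (rev_ord j)).
exists (fun j => ~~ b (rev_ord j)); split=> [j//|].
apply: free_trans (free_eq_inv wE) _; rewrite word_inv_bigcat.
apply: free_eq_bigcat => j; rewrite !word_inv_cat word_invK -catA.
by case: (b _); rewrite /= ?word_invK; exact: free_refl.
Qed.

Lemma free_eq_eval v w : free_eq v w -> ev v = ev w.
Proof.
elim=> {v w} [//|v w _ ->//|u v w _ -> _ ->//|u v x b].
rewrite !word_eval_cat -cat1s -[_ :: v]cat1s !word_eval_cat; congr (_ * _).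
rewrite mulgA -[RHS]mul1g; congr (_ * _).
by rewrite /word_eval !big_seq1 /=; case: b; rewrite ?mulgV ?mulVg.
Qed.

Lemma filling_eval w N : filling w N -> ev w = 1.
Proof.
move=> [u [r [b [rP /free_eq_eval ->]]]].
elim/big_ind: _ => [|x y x1 y1|j _]; first exact: word_eval_nil.
  by rewrite word_eval_cat x1 y1 mulg1.
have e : ev (if b j then word_inv (r j) else r j) = 1.
  by case: (b j); rewrite ?word_eval_inv (rP j).2 ?invg1.
by rewrite !word_eval_cat e mul1g word_eval_inv mulgV.
Qed.

(** Rewriting of words with a cost. Costs add up under [homotopic_trans] and [homotopic_cat], so
    that later bounds can be summed step by step. *)
Definition homotopic N v w := filling (v ++ word_inv w) N.

Lemma homotopic_refl w : homotopic 0 w w.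
Proof. by apply: filling0; exact: free_eqV. Qed.

Lemma homotopic_leq N M v w : (N <= M)%N -> homotopic N v w -> homotopic M v w.
Proof. exact: filling_leq. Qed.

Lemma homotopic_sym N v w : homotopic N v w -> homotopic N w v.
Proof. by move=> /filling_inv; rewrite word_inv_cat word_invK. Qed.

Lemma homotopic_eval N v w : homotopic N v w -> ev v = ev w.
Proof.
move=> /filling_eval; rewrite word_eval_cat word_eval_inv => e.
by rewrite -[LHS]mulg1 -(mulVg (ev w)) mulgA e mul1g.
Qed.

Lemma homotopic_trans v N M u w : homotopic N u v -> homotopic M v w -> homotopic (N + M) u w.
Proof.
move=> uv vw; apply: filling_free_eq (filling_cat uv vw).
apply: free_sym; have := free_eq_ctx u (word_inv w) (free_eqVl v).
by rewrite -!catA.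
Qed.

Lemma homotopic_cat N M u u' v v' :
  homotopic N u u' -> homotopic M v v' -> homotopic (N + M) (u ++ v) (u' ++ v').
Proof.
move=> h1 h2; rewrite addnC; apply: filling_free_eq (filling_cat (filling_conj u h2) h1).
rewrite word_inv_cat; apply: free_sym.
have := free_eq_ctx (u ++ v ++ word_inv v') (word_inv u') (free_eqVl u).
by rewrite -!catA.
Qed.

Lemma homotopic_inv N v w : homotopic N v w -> homotopic N (word_inv v) (word_inv w).
Proof.
move=> h; rewrite /homotopic word_invK; have := filling_conj (word_inv v) (homotopic_sym h).
apply: filling_free_eq; rewrite word_invK -!catA; apply: free_sym.
have := free_eq_ctx (word_inv v ++ w) [::] (free_eqVl v).
by rewrite !cats0 -!catA.
Qed.

Lemma filling_homotopic N M v w : homotopic N v w -> filling w M -> filling v (N + M).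
Proof.
move=> h1 h2; apply: filling_free_eq (filling_cat h1 h2); apply: free_sym.
by have := free_eq_ctx v [::] (free_eqVl w); rewrite !cats0 -!catA.
Qed.

Variable delta : nat -> nat.
Hypothesis presented : presented i S m.
Hypothesis dehn : forall n, supremums (areas i S m n) (delta n).

(** The presentation provides some filling; the least one is an [area], hence below the supremum,
    and padding reaches [delta n] itself. *)
Lemma filling_dehn n w : relation_le i n w -> filling w (delta n).
Proof.
move=> [sw ew].
have ex : exists N, `[< filling w N >].
  by have [_ /(_ w ew)[N wN]] := presented; exists N; apply/asboolP.
case: (ex_minnP ex) => a /asboolP => fa amin.
have /(_ a) := (dehn n).1; move=> aP; apply: (filling_leq _ fa).
rewrite -leEnat; apply: aP; exists w; split; [by [] | split=> [|N fN]].
  exact: fa.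
by apply: amin; apply/asboolP.
Qed.

(** Every local step below is paid this way: words of bounded length with the same value are
    exchanged at constant cost. *)
Lemma homotopic_dehn n v w : (size v + size w <= n)%N -> ev v = ev w ->
  homotopic (delta n) v w.
Proof.
move=> sz e; apply: filling_dehn; split; first by rewrite size_cat size_word_inv.
by rewrite word_eval_cat word_eval_inv e mulgV.
Qed.

Lemma presented_subgroup : subgroup (range i).
Proof.
have [<- _] := presented; split.
- by exists [::] => //; exact: word_eval_nil.
- by move=> _ _ [v _ <-] [w _ <-]; exists (v ++ w) => //; exact: word_eval_cat.
- by move=> _ [w _ <-]; exists (word_inv w) => //; exact: word_eval_inv.
Qed.

Lemma dehn_mono n n' : (n <= n')%N -> (delta n <= delta n')%N.
Proof.
move=> nn'; rewrite -leEnat; apply: (dehn n).2 => a [w [[sw ew] wa]].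
by apply: (dehn n').1; exists w; split=> //; split=> //; exact: leq_trans nn'.
Qed.

Lemma dehn_le n M :
  (forall w, relation_le i n w -> filling w M) -> (delta n <= M)%N.
Proof.
move=> H; rewrite -leEnat; apply: (dehn n).2 => a [w [wn [wa amin]]].
by rewrite leEnat; apply: amin; exact: H.
Qed.

End Fillings.

(** * Portraits of tree automorphisms *)

Section RayCat.
Variable d : nat.
Implicit Types (u v : seq 'I_d) (xi eta : ray d).

Lemma ray_cat_lt u xi n x0 : (n < size u)%N -> ray_cat u xi n = nth x0 u n.
Proof. by move=> nu; rewrite /ray_cat; apply: set_nth_default. Qed.

Lemma ray_cat_ge u xi n : (size u <= n)%N -> ray_cat u xi n = xi (n - size u)%N.
Proof. by move=> un; rewrite /ray_cat nth_default. Qed.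

Lemma ray_cat0 xi : ray_cat [::] xi = xi.
Proof. by apply/funext => n; rewrite ray_cat_ge // subn0. Qed.

Lemma ray_cat_cat u v xi : ray_cat (u ++ v) xi = ray_cat u (ray_cat v xi).
Proof.
apply/funext => n; rewrite /ray_cat nth_cat size_cat subnDA.
case: (ltnP n (size u)) => nu; first exact: set_nth_default.
by rewrite [RHS]nth_default.
Qed.

Lemma mkseq_ray_cat u xi n :
  mkseq (ray_cat u xi) (size u + n) = u ++ mkseq xi n.
Proof.
apply: (@eq_from_nth _ (xi 0)); first by rewrite size_cat !size_mkseq.
move=> j; rewrite size_mkseq => jn; rewrite nth_mkseq// nth_cat.
case: ltnP => ju; first by rewrite (ray_cat_lt _ (xi 0)).
by rewrite ray_cat_ge// nth_mkseq//; lia.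
Qed.

Lemma mkseq_ray_cat_size u xi : mkseq (ray_cat u xi) (size u) = u.
Proof. by have := mkseq_ray_cat u xi 0; rewrite addn0 cats0. Qed.

Lemma ray_cat_mkseq xi n : ray_cat (mkseq xi n) (fun j => xi (n + j)%N) = xi.
Proof.
apply/funext => j; case: (ltnP j n) => jn.
  by rewrite (ray_cat_lt _ (xi 0)) ?size_mkseq// nth_mkseq.
by rewrite ray_cat_ge ?size_mkseq// subnKC.
Qed.

Lemma ray_cat_inj u : injective (ray_cat u).
Proof.
move=> xi eta /funeqP e; apply/funext => n.
have := e (size u + n)%N; rewrite !ray_cat_ge ?leq_addr//.
by rewrite addKn.
Qed.

Lemma ray_cat_eq u v xi eta : size u = size v ->
  ray_cat u xi = ray_cat v eta -> u = v /\ xi = eta.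
Proof.
move=> uv e; have e' := congr1 (fun z => mkseq z (size u)) e.
rewrite {2}uv !mkseq_ray_cat_size in e'; split=> //.
by rewrite e' in e; exact: ray_cat_inj e.
Qed.

End RayCat.

Section Portraits.
Variable d : nat.
Implicit Types (u v : seq 'I_d) (xi eta : ray d).

(* A portrait gives the local permutations of a tree automorphism. *)
Definition portrait := seq 'I_d -> 'S_d.
Implicit Types s t : portrait.

Definition sec s u : portrait := fun v => s (u ++ v).

Fixpoint act s v : seq 'I_d :=
  if v is x :: v' then s [::] x :: act (sec s [:: x]) v' else [::].

Fixpoint iact s v : seq 'I_d :=
  if v is y :: v' then
    (s [::])^-1 y :: iact (sec s [:: (s [::])^-1 y]) v'
  else [::].

Definition ract s xi : ray d := fun n => s (mkseq xi n) (xi n).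

Definition pid : portrait := fun=> 1.
(** Permutations multiply from left to right, while [bij_mul] composes from right to left. So [t v],
    applied first, stands on the left, although this is the portrait of [s] after [t]. *)
Definition pcomp s t : portrait := fun v => t v * s (act t v).
Definition pinv s : portrait := fun v => (s (iact s v))^-1.

Lemma sec_sec s u v : sec (sec s u) v = sec s (u ++ v).
Proof. by apply/funext => w; rewrite /sec catA. Qed.

Lemma size_act s v : size (act s v) = size v.
Proof. by elim: v s => //= x v IH s; rewrite IH. Qed.

Lemma act_cat s u v : act s (u ++ v) = act s u ++ act (sec s u) v.
Proof. by elim: u s => //= x u IH s; rewrite IH sec_sec. Qed.

Lemma act_rcons s v x : act s (rcons v x) = rcons (act s v) (s v x).
Proof. by rewrite -cats1 act_cat /= /sec cats0 cats1. Qed.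

Lemma actK s : cancel (act s) (iact s).
Proof. by move=> v; elim: v s => //= x v IH s; rewrite permK IH. Qed.

Lemma iactK s : cancel (iact s) (act s).
Proof. by move=> v; elim: v s => //= x v IH s; rewrite permKV IH. Qed.

Lemma iact_rcons s v y :
  iact s (rcons v y) = rcons (iact s v) ((s (iact s v))^-1 y).
Proof.
by apply: (can_inj (actK s)); rewrite act_rcons !iactK permKV.
Qed.

Lemma act_pinv s v : act (pinv s) v = iact s v.
Proof.
by elim/last_ind: v => // v x IH; rewrite act_rcons IH iact_rcons.
Qed.

Lemma act_pid v : act pid v = v.
Proof. by elim: v => //= x v IH; rewrite perm1 -[in RHS]IH. Qed.

Lemma act_pcomp s t v : act (pcomp s t) v = act s (act t v).
Proof.
by elim/last_ind: v => // v x IH; rewrite !act_rcons IH permM.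
Qed.

Lemma mkseq_ract s xi n : mkseq (ract s xi) n = act s (mkseq xi n).
Proof. by elim: n => // n IH; rewrite !mkseqS IH act_rcons. Qed.

Lemma ract_pid xi : ract pid xi = xi.
Proof. by apply/funext => n; rewrite /ract perm1. Qed.

Lemma ract_pcomp s t xi : ract (pcomp s t) xi = ract s (ract t xi).
Proof. by apply/funext => n; rewrite /ract/= mkseq_ract permM. Qed.

Lemma ractK s : cancel (ract s) (ract (pinv s)).
Proof.
by move=> xi; apply/funext => n; rewrite /ract mkseq_ract /pinv actK permK.
Qed.

Lemma ractVK s : cancel (ract (pinv s)) (ract s).
Proof.
move=> xi; apply/funext => n.
by rewrite /ract mkseq_ract act_pinv /pinv permKV.
Qed.

Lemma ract_ray_cat s u xi :
  ract s (ray_cat u xi) = ray_cat (act s u) (ract (sec s u) xi).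
Proof.
apply/funext => n; case: (ltnP n (size u)) => nu; last first.
  rewrite ray_cat_ge ?size_act// /ract ray_cat_ge//.
  by rewrite -{1}(subnKC nu) mkseq_ray_cat.
have := mkseq_ract s (ray_cat u xi) (size u).
rewrite mkseq_ray_cat_size => /(congr1 (fun z => nth (xi 0) z n)).
by rewrite nth_mkseq// => ->; rewrite (ray_cat_lt _ (xi 0)) ?size_act.
Qed.

Lemma ract_inj s t : (forall xi, ract s xi = ract t xi) -> s = t.
Proof.
move=> st; apply/funext => v; apply/permP => x.
have /funeqP/(_ (size v)) := st (ray_cat v (fun=> x)).
by rewrite /ract mkseq_ray_cat_size ray_cat_ge.
Qed.

End Portraits.

(** * The group W(D) in terms of portraits *)

Section WreathPortraits.
Variables (d : nat) (D : {group 'S_d}).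
Implicit Types (s t : portrait d) (g : bij (seq 'I_d)).

Definition portrait_in s := forall v, s v \in D.

Lemma portrait_in_pid : portrait_in (@pid d). Proof. by move=> v; exact: group1. Qed.
Lemma portrait_in_pcomp s t : portrait_in s -> portrait_in t -> portrait_in (pcomp s t).
Proof. by move=> sD tD v; apply: groupM; [exact: tD|exact: sD]. Qed.
Lemma portrait_in_pinv s : portrait_in s -> portrait_in (pinv s).
Proof. by move=> sD v; rewrite groupV; exact: sD. Qed.
Lemma portrait_in_sec s u : portrait_in s -> portrait_in (sec s u).
Proof. by move=> sD v; exact: sD. Qed.

Definition act_bij s : bij (seq 'I_d) := Bij (actK s) (iactK s).

Lemma adjacent_act s u v : adjacent u v -> adjacent (act s u) (act s v).
Proof.
move=> [x [->|->]]; rewrite act_rcons; first by exists (s u x); left.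
by exists (s v x); right.
Qed.

Lemma tree_aut_act s g : g =1 act s -> tree_aut g.
Proof.
move=> gs; split=> [|u v]; first by rewrite gs.
rewrite !gs; split=> [|h]; first exact: adjacent_act.
rewrite -(actK s u) -(actK s v) -!act_pinv; exact: adjacent_act.
Qed.

(** Automorphisms with local permutations in [D] form a closed subgroup containing every D_n, so
    they contain the intersection defining [W D]. Conversely, such an automorphism is the limit of
    its truncations, and these lie in the D_n. *)
Lemma WP g : W D g <-> exists2 s, portrait_in s & g =1 act s.
Proof.
split=> [Wg|[s sD gs] H [Haut Hgrp Hcl HD]].
  apply: (Wg [set h : bij (seq 'I_d) | exists2 s, portrait_in s & h =1 act s]); split.
  - by move=> h [s _ hs]; exact: tree_aut_act hs.
  - split; first by exists (@pid d) => [|v]; rewrite ?act_pid//; exact: portrait_in_pid.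
      move=> g1 g2 [s sD gs] [t tD ht]; exists (pcomp s t).
        exact: portrait_in_pcomp.
      by move=> v; rewrite act_pcomp -ht -gs.
    move=> g1 [s sD gs]; exists (pinv s); first exact: portrait_in_pinv.
    move=> v; rewrite act_pinv; apply: (can_inj (actK s)).
    by rewrite iactK -gs; exact: bij_invK.
  - move=> h haut happ.
    have /choice[F FP] : forall n, exists s, portrait_in s /\
        forall v, (size v <= n)%N -> act s v = h v.
      move=> n; have [f [[s sD fs] fh]] := happ n; exists s; split=> // v vn.
      by rewrite -fs fh.
    (* An approximation of [h] up to length [size v + 1] already determines the local permutation at
       [v], so the portrait is assembled diagonally. *)
    exists (fun v => F (size v).+1 v) => [v|]; first exact: (FP _).1.
    elim/last_ind => [|v x IH]; first by rewrite haut.1.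
    have [_ e] := FP (size v).+1.
    by rewrite act_rcons -IH -e ?size_rcons// act_rcons e.
  - move=> n n0 f [f0 [s sP]]; exists s => [v|].
      have [_ s1 s2] := sP v; case: (ltnP (size v) n) => vn; first exact: s1.
      by rewrite s2.
    elim/last_ind => [|v x IH]; first by rewrite f0.
    by have [-> _ _] := sP v; rewrite act_rcons IH.
apply: Hcl => [|n]; first exact: tree_aut_act gs.
pose t v := if (size v < n.+1)%N then s v else 1.
exists (act_bij t); split.
  apply: (HD n.+1) => //; split=> //; exists t => v; split=> //=.
  - by move=> x; rewrite act_rcons.
  - by move=> vn; rewrite /t vn; exact: sD.
  - by move=> vn; rewrite /t ltnNge vn.
elim/last_ind => [|v x IH]; first by rewrite gs.
rewrite size_rcons => vn; rewrite gs /= !act_rcons -gs -IH 1?ltnW//=.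
by rewrite /t ltnS ltnW.
Qed.

Lemma ray_act_ract s g xi : g =1 act s -> ray_act g xi = ract s xi.
Proof.
by move=> gs; apply/funext => n; rewrite /ray_act gs mkseqS act_rcons last_rcons.
Qed.

End WreathPortraits.

(** * Local description of almost automorphisms *)

(** A strictly increasing permutation moves no point down; this applies to [s] and to its
    inverse. *)
Lemma monotone_perm1 d (s : 'S_d) :
  (forall x y : 'I_d, (x < y)%N -> (s x < s y)%N) -> s = 1.
Proof.
have ge (t : 'S_d) : (forall x y : 'I_d, (x < y)%N -> (t x < t y)%N) ->
    forall x : 'I_d, (x <= t x)%N.
  move=> tm x; have [n xn] := ubnP (val x); elim: n x xn => // n IH x xn.
  rewrite leqNgt; apply/negP => tx; have := IH (t x) (leq_trans tx xn).
  by rewrite leqNgt tm.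
move=> sm; apply/permP => x; rewrite perm1; apply: val_inj; apply/eqP.
rewrite eqn_leq ge// andbT.
have := ge s^-1 _ (s x); rewrite permK; apply => y z yz.
rewrite ltnNge; apply/negP; rewrite leq_eqVlt => /orP[/eqP/val_inj/perm_inj e|].
  by rewrite e ltnn in yz.
by move=> /sm; rewrite !permKV ltnNge ltnW.
Qed.

(** [tree_aut] only preserves unoriented adjacency. Going down the tree, the neighbour of [g v]
    towards the root is already the image of the parent of [v], so injectivity sends children to
    children. *)
Lemma tree_aut_portrait d (g : bij (seq 'I_d)) :
  tree_aut g -> exists s : portrait d, g =1 act s.
Proof.
move=> [g0 gadj].
have child v x : exists y, g (rcons v x) = rcons (g v) y.
  elim/last_ind: v x => [|v z IH] x; last first.
    have [y yE] := IH z.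
    have /(gadj _ _).1[x'] : adjacent (rcons v z) (rcons (rcons v z) x).
      by exists x; left.
    case=> [->|]; first by exists x'.
    rewrite yE => /rcons_inj[e _]; have := can_inj (bij_funK g) e.
    by move=> /(congr1 size); rewrite !size_rcons => ?; lia.
  have /(gadj _ _).1[x'] : adjacent [::] [:: x] by exists x; left.
  by rewrite g0; case=> [->|]; [exists x'|case: (g _)].
have /choice[F FP] : forall v, exists s : 'S_d,
    forall x, g (rcons v x) = rcons (g v) (s x).
  move=> v; have /choice[s sP] := child v.
  have si : injective s.
    move=> x y e; have : g (rcons v x) = g (rcons v y) by rewrite !sP e.
    by move=> /(can_inj (bij_funK g))/rcons_inj[].
  by exists (perm si) => x; rewrite permE.
exists F; elim/last_ind => [|v x IH]; first by rewrite g0.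
by rewrite act_rcons -IH.
Qed.

Section Boundary.
Variables (k d : nat).
Hypothesis hd : (1 < d)%N.
Implicit Types (p q : vertex k d) (xi eta : ray d) (f g : bij (boundary k d)).
Implicit Types (s t : 'I_k -> portrait d) (D : {group 'S_d}).

Let x0 : 'I_d := Ordinal (ltnW hd).

Lemma bd_cat_inj p : injective (bd_cat p).
Proof. by move=> xi eta [] /ray_cat_inj. Qed.

Lemma bd_cat_eq p q xi eta : size p.2 = size q.2 ->
  bd_cat p xi = bd_cat q eta -> p = q /\ xi = eta.
Proof.
by case: p q => [a u] [b v] /= uv [<-] /(ray_cat_eq uv)[-> ->].
Qed.

Lemma bd_cat_cat a u v xi :
  bd_cat (a, u ++ v) xi = bd_cat (a, u) (ray_cat v xi) :> boundary k d.
Proof. by rewrite /bd_cat /= ray_cat_cat. Qed.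

Lemma bd_cat_split (x : boundary k d) n :
  exists p xi, size p.2 = n /\ x = bd_cat p xi.
Proof.
case: x => a xi; exists (a, mkseq xi n), (fun j => xi (n + j)%N).
by rewrite /bd_cat /= size_mkseq ray_cat_mkseq.
Qed.

Lemma bij_ext_level n f g :
  (forall p xi, size p.2 = n -> f (bd_cat p xi) = g (bd_cat p xi)) -> f = g.
Proof.
move=> fg; apply: bij_eq => x.
by have [p [xi [pn ->]]] := bd_cat_split x n; exact: fg.
Qed.

Definition bact s : bij (boundary k d) :=
  @Bij (boundary k d) (fun x => (x.1, ract (s x.1) x.2))
    (fun x => (x.1, ract (pinv (s x.1)) x.2))
    ltac:(by case=> a xi /=; rewrite ractK)
    ltac:(by case=> a xi /=; rewrite ractVK).

Lemma bactM s t : bact s * bact t = bact (fun a => pcomp (s a) (t a)).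
Proof. by apply: bij_eq => -[a xi] /=; rewrite ract_pcomp. Qed.

Lemma bactV s : (bact s)^-1 = bact (fun a => pinv (s a)).
Proof. exact: bij_eq. Qed.

Lemma bact1 : bact (fun=> @pid d) = 1.
Proof. by apply: bij_eq => -[a xi] /=; rewrite ract_pid. Qed.

Lemma bact_inj : injective bact.
Proof.
move=> s t st; apply/funext => a; apply: ract_inj => xi.
by have /(congr1 (fun f : bij _ => f (a, xi)))[] := st.
Qed.

Lemma bact_cat s p xi : bact s (bd_cat p xi) =
  bd_cat (p.1, act (s p.1) p.2) (ract (sec (s p.1) p.2) xi).
Proof. by rewrite /bd_cat /= ract_ray_cat. Qed.

Definition portraits_in D s := forall a, portrait_in D (s a).
Definition triv n s := forall a v, (size v < n)%N -> s a v = 1.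

Lemma act_triv n s a v : triv n s -> (size v <= n)%N -> act (s a) v = v.
Proof.
move=> st; elim/last_ind: v => // v x IH; rewrite size_rcons => vn.
by rewrite act_rcons IH 1?ltnW// st// perm1.
Qed.

Lemma triv_leq m n s : (m <= n)%N -> triv n s -> triv m s.
Proof. by move=> mn st a v vm; apply: st; exact: leq_trans vm mn. Qed.

(** These are the level stabilizers of W_k(D), by [WkE] and [Wk_stabE]. The portrait is determined
    by [f] ([bact_inj]), so membership can be read off vertex by vertex. *)
Definition K D n : set (bij (boundary k d)) :=
  [set f | exists s, [/\ portraits_in D s, triv n s & f = bact s]].

Lemma K_leq D m n : (m <= n)%N -> K D n `<=` K D m.
Proof.
move=> mn f [s [sD st fE]]; exists s; split=> //; exact: triv_leq st.
Qed.

Lemma K1 D n : K D n 1.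
Proof.
exists (fun=> @pid d); split=> //; last by rewrite bact1.
by move=> a; exact: portrait_in_pid.
Qed.

Lemma KM D n f g : K D n f -> K D n g -> K D n (f * g).
Proof.
move=> [s [sD st ->]] [t [tD tt ->]].
exists (fun a => pcomp (s a) (t a)); split; last by rewrite bactM.
  by move=> a; exact: portrait_in_pcomp.
by move=> a v vn; rewrite /pcomp tt// st ?mulg1// size_act.
Qed.

Lemma iact_triv n s a v : triv n s -> (size v <= n)%N -> iact (s a) v = v.
Proof. by move=> st vn; rewrite -[in LHS](act_triv a st vn) actK. Qed.

Lemma KV D n f : K D n f -> K D n f^-1.
Proof.
move=> [s [sD st ->]]; exists (fun a => pinv (s a)); split.
- by move=> a; exact: portrait_in_pinv.
- by move=> a v vn; rewrite /pinv (iact_triv a st) ?(ltnW vn)// st ?invg1.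
- by rewrite bactV.
Qed.

Lemma WkE D f : Wk D f <-> K D 0 f.
Proof.
split=> [[w [wD wE]]|[s [sD _ ->]]].
  have /choice[s sP] : forall a, exists s : portrait d, portrait_in D s /\ w a =1 act s.
    by move=> a; have /WP[s sD ws] := wD a; exists s.
  exists s; split=> //; first by move=> a; exact: (sP a).1.
  by apply: bij_eq => -[a xi]; rewrite wE (ray_act_ract _ (sP a).2).
exists (fun a => act_bij (s a)); split=> [a|a xi].
  by apply/WP; exists (s a).
by rewrite (@ray_act_ract _ (s a)).
Qed.

Lemma Wk_stabE D n f : Wk_stab D n f <-> K D n f.
Proof.
split=> [[/WkE[s [sD _ ->]] fix_]|fK].
  exists s; split=> // a v vn; apply/permP => x; rewrite perm1.
  have vxn : (size (rcons v x) <= n)%N by rewrite size_rcons.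
  have [eta] := fix_ a (rcons v x) (fun=> x0) vxn.
  rewrite bact_cat => /bd_cat_eq[|]; first by rewrite size_act.
  by rewrite /= act_rcons => -[/rcons_inj[_ ->]].
split; first by apply/WkE; exact: K_leq fK.
move=> a v xi vn; have [s [sD st ->]] := fK.
by rewrite bact_cat (act_triv _ st)//; eexists.
Qed.

Definition replaces f p q := forall xi, f (bd_cat p xi) = bd_cat q xi.

Definition locally_W D n f := forall p, size p.2 = n -> exists q (s : portrait d),
  portrait_in D s /\ forall xi, f (bd_cat p xi) = bd_cat q (ract s xi).

Definition locally_replaces n f := forall p, size p.2 = n -> exists q, replaces f p q.

(** The longest prefix of [p.2] lying in [T] is a leaf: if it had any child in [T], closure under
    siblings would put the next prefix of [p.2] into [T]. *)
Lemma leaf_prefix (T : {fset 'I_k * seq 'I_d}) : complete_subtree T ->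
  exists N, forall p, size p.2 = N ->
    exists2 j, (j <= N)%N & leaf T (p.1, take j p.2).
Proof.
move=> [T0 Tpre Tsib]; exists (\max_(p <- T) size p.2).+1 => -[a v] /= vN.
set N := (\max_(p <- T) size p.2).+1 in vN *.
have ltN q : q \in T -> (size q.2 < N)%N.
  by move=> qT; rewrite ltnS; 
  exact: (@leq_bigmax_seq _ (enum_fset T) xpredT (fun q => size q.2) q qT isT).
pose P j := ((a, take j v) \in T) && (j <= N)%N.
have exP : exists j, P j by exists 0; rewrite /P take0 T0.
have PN j : P j -> (j <= N)%N by case/andP.
case: (ex_maxnP exP PN) => j /andP[jT jN] jmax; exists j => //; split=> //= x.
have {}jN : (j < N)%N.
  by move: (ltN _ jT); rewrite /= size_take vN; case: (ltnP j N) => //; rewrite ltnn.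
apply/negP => xT; have := jmax j.+1; rewrite /P jN andbT.
rewrite (take_nth x) ?vN// => /(_ (Tsib _ _ _ _ xT)).
by rewrite ltnn.
Qed.

Lemma AAutD_loc D f : AAutD D f -> exists n, locally_W D n f.
Proof.
move=> [T [T' [sigma [phi [[Tc _ _ _ fE] phiW]]]]].
have [N NP] := leaf_prefix Tc; exists N => p /NP[j jN lj].
have /WP[s sD sP] := phiW _ lj; have {sP fE}fE xi :
    f (bd_cat (p.1, take j p.2) xi) =
    bd_cat (sigma (p.1, take j p.2)) (ract s xi).
  by rewrite fE// (ray_act_ract _ sP).
move: fE; set q := sigma _; case: q => b u fE.
exists (b, u ++ act s (drop j p.2)), (sec s (drop j p.2)).
split=> [|xi]; first exact: portrait_in_sec.
rewrite bd_cat_cat -ract_ray_cat -fE -bd_cat_cat cat_take_drop.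
by case: (p).
Qed.

Lemma AAutD_sub D D' f : D \subset D' -> AAutD D f -> AAutD D' f.
Proof.
move=> /fintype.subsetP DD' [T [T' [sigma [phi [fP phiW]]]]].
exists T, T', sigma, phi; split=> // p /phiW/WP[s sD sP].
by apply/WP; exists s => [v|]; [apply: DD'; exact: sD|exact: sP].
Qed.

Lemma bd_lt_cat p xi eta : bd_lt (bd_cat p xi) (bd_cat p eta) <->
  exists n, (forall j, (j < n)%N -> xi j = eta j) /\ (xi n < eta n)%N.
Proof.
split=> [[|[_ [n [e l]]]]|[n [e l]]]; first by rewrite ltnn.
  rewrite /= in e l.
  have pn : (size p.2 <= n)%N.
    by rewrite leqNgt; apply/negP => np; move: l; rewrite !(ray_cat_lt _ x0)// ltnn.
  exists (n - size p.2)%N; split=> [j jn|]; last by rewrite !ray_cat_ge in l.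
  by have := e (size p.2 + j)%N; rewrite !ray_cat_ge ?leq_addr// addKn; apply; lia.
right; split=> //; exists (size p.2 + n)%N; split=> [j jn|] /=; last first.
  by rewrite !ray_cat_ge ?leq_addr// addKn.
case: (ltnP j (size p.2)) => jp; first by rewrite !(ray_cat_lt _ x0).
by rewrite !ray_cat_ge// e//; lia.
Qed.

(** Two rays that separate just below [v] are compared, after applying [s], by the images of their
    letters there. Preserving the order on the cone thus makes each local permutation increasing. *)
Lemma monotone_portrait (s : portrait d) p q :
  (forall xi eta, bd_lt (bd_cat p xi) (bd_cat p eta) ->
    bd_lt (bd_cat q (ract s xi)) (bd_cat q (ract s eta))) ->
  s = @pid d.
Proof.
move=> sm; apply/funext => v; apply: monotone_perm1 => x y xy.
pose xi z := ray_cat v (fun=> z) : ray d.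
have xiE z j : (j < size v)%N -> ract s (xi z) j = nth x0 (act s v) j.
  by move=> jv; rewrite ract_ray_cat (ray_cat_lt _ x0) ?size_act.
have xiE' z : ract s (xi z) (size v) = s v z.
  by rewrite /ract mkseq_ray_cat_size /xi ray_cat_ge.
have /sm/bd_lt_cat : bd_lt (bd_cat p (xi x)) (bd_cat p (xi y)).
  apply/bd_lt_cat; exists (size v); rewrite /xi; split; last by rewrite !ray_cat_ge.
  by move=> j jv; rewrite !(ray_cat_lt _ x0).
move=> [n [e l]]; case: (ltngtP n (size v)) => nv.
- by move: l; rewrite !xiE// ltnn.
- move: (e _ nv); rewrite !xiE' => /perm_inj exy; by rewrite exy ltnn in xy.
- by move: l; rewrite nv !xiE'.
Qed.

(** A tree automorphism that preserves the order of a component has trivial portrait, so the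
    identity can take its place in the triple. The results on [AAutD] thereby apply to V. *)
Lemma HT_AAut1 f : HT f -> AAutD 1%G f.
Proof.
move=> [T [T' [sigma [phi [[Tc T'c sb phiA fE] fm]]]]].
exists T, T', sigma, (fun=> 1); split; last first.
  move=> p _; apply/WP; exists (@pid d); first exact: portrait_in_pid.
  by move=> v; rewrite act_pid.
split=> // p xi lp.
rewrite fE//; have [s sP] := tree_aut_portrait (phiA _ lp).
rewrite (ray_act_ract _ sP); have fE' eta : f (bd_cat p eta) =
    bd_cat (sigma p) (ract s eta) by rewrite fE// (ray_act_ract _ sP).
have -> : s = @pid d.
  apply: (@monotone_portrait s p (sigma p)) => e1 e2 /(fm _ _ _ lp).
  by rewrite !fE'.
rewrite ract_pid (@ray_act_ract _ (@pid d)) ?ract_pid// => v.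
by rewrite act_pid.
Qed.

Lemma HT_AAutD D f : HT f -> AAutD D f.
Proof. by move=> /HT_AAut1; apply: AAutD_sub; exact: sub1G. Qed.

Lemma HT_loc f : HT f -> exists n, locally_replaces n f.
Proof.
move=> /HT_AAut1/AAutD_loc[n nP]; exists n => p /nP[q [s [sD fE]]].
exists q => xi; rewrite fE; congr bd_cat; apply/funext => j.
by rewrite /ract; have /set1P -> := sD (mkseq xi j); rewrite perm1.
Qed.

End Boundary.

(** * Recognizing elements of V by prefix replacement *)

Section Thompson.
Variables (k d : nat).
Hypothesis hd : (1 < d)%N.
Implicit Types (p q : vertex k d) (xi eta : ray d) (f g : bij (boundary k d)).
Implicit Types (D : {group 'S_d}).

Let x0 : 'I_d := Ordinal (ltnW hd).

Definition vertices n : seq ('I_k * seq 'I_d) :=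
  [seq (a, v) | a <- enum 'I_k, v <- [seq val v | v <- enum {: n.-bseq 'I_d}]].

Lemma mem_vertices n (p : 'I_k * seq 'I_d) :
  (p \in vertices n) = (size p.2 <= n)%N.
Proof.
apply/allpairsP/idP => [[[a v] /= [_ /mapP[w _ ->] ->]]|pn].
  exact: (valP w).
exists p; rewrite mem_enum; split=> //; last by case: p pn.
by apply/mapP; exists (Bseq pn) => //; rewrite mem_enum.
Qed.

Lemma replaces_prefix_inj f p p' q q' n : size p.2 = n -> size p'.2 = n ->
  replaces f p q -> replaces f p' q' -> q.1 = q'.1 -> prefix q.2 q'.2 -> p = p'.
Proof.
move=> pn p'n cp cp' e /prefixP[w wE].
have : f (bd_cat p (ray_cat w (fun=> x0))) = f (bd_cat p' (fun=> x0)).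
  rewrite cp cp' /bd_cat e wE; congr pair.
  by rewrite ray_cat_cat.
by move=> /(can_inj (bij_funK f))/bd_cat_eq[|]//; rewrite pn.
Qed.

(** [T] consists of all words of length at most [n], and [T'] of all prefixes of the targets [Q p].
    Surjectivity of [f] makes [T'] closed under siblings; injectivity makes the [Q p] incomparable,
    hence exactly the leaves. *)
Lemma locally_replaces_HT n f : locally_replaces n f -> HT f.
Proof.
move=> fV.
have /choice[Q QP] : forall p, exists q, size p.2 = n -> replaces f p q.
  move=> p; case: (pselect (size p.2 = n)) => [/fV[q ?]|pn]; first by exists q.
  by exists p.
have Qcov a xi : exists2 p, size p.2 = n & exists m, Q p = (a, mkseq xi m).
  have [p [eta [pn pE]]] := bd_cat_split (bij_inv f (a, xi)) n.
  exists p => //; have := QP p pn eta; rewrite -pE bij_invK.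
  case: (Q p) => b u [-> ->]; exists (size u).
  by rewrite mkseq_ray_cat_size.
have Qpre p p' : size p.2 = n -> size p'.2 = n -> (Q p).1 = (Q p').1 ->
    prefix (Q p).2 (Q p').2 -> p = p'.
  by move=> pn p'n; exact: (replaces_prefix_inj pn p'n (QP _ pn) (QP _ p'n)).
pose T := [fset p in vertices n]%fset.
pose T' := [fset p in [seq ((Q p).1, take j (Q p).2) |
  p <- [seq p <- vertices n | size p.2 == n], j <- iota 0 (size (Q p).2).+1]]%fset.
have TE p : (p \in T) = (size p.2 <= n)%N by rewrite inE mem_vertices.
have T'P p : p \in T' <-> exists p', [/\ size p'.2 = n, (Q p').1 = p.1 &
    prefix p.2 (Q p').2].
  rewrite inE; split=> [/allpairsPdep[p' [j []]]|[p' [p'n e]]].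
    rewrite mem_filter => /andP[/eqP p'n _] _ ->.
    by exists p'; split=> //=; rewrite -{2}(cat_take_drop j (Q p').2) prefix_prefix.
  move=> /prefixP[w wE]; apply/allpairsPdep; exists p', (size p.2).
  rewrite mem_filter p'n eqxx mem_vertices p'n leqnn mem_iota wE size_cat.
  split=> //; first lia.
  by rewrite take_size_cat// e; case: (p).
have leafT p : leaf T p <-> size p.2 = n.
  split=> [[]|pn]; last first.
    by split=> [|x]; rewrite TE ?pn//= size_rcons pn ltnn.
  by rewrite TE => pn /(_ x0); rewrite TE /= size_rcons => ?; lia.
have leafT' p : leaf T' p <-> exists2 p0, size p0.2 = n & p = Q p0.
  split=> [[/T'P[p0 [p0n e /prefixP[[|x w] wE]]] leafp]|[p0 p0n ->]].
  - exists p0 => //; move: e wE; rewrite cats0.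
    by case: (p) (Q p0) => [? ?] [? ?] /= <- <-.
  - have /negP[] := leafp x; apply/T'P; exists p0; split=> //=.
    by apply/prefixP; exists w; rewrite cat_rcons.
  - split=> [|x]; first by apply/T'P; exists p0; split=> //; exact: prefix_refl.
    apply/negP => /T'P[p1 /= [p1n e pre]].
    have p10 : p0 = p1.
      apply: Qpre => //; move/prefixP: pre => [w ->].
      by rewrite -cats1 -catA prefix_prefix.
    by move: (size_prefix pre); rewrite p10 size_rcons ltnn.
exists T, T', Q, (fun=> 1).
have r1 xi : ray_act 1 xi = xi.
  by rewrite (@ray_act_ract _ (@pid d)) ?ract_pid// => v; rewrite act_pid.
split; last first.
  move=> p xi eta /leafT/QP cp; rewrite !cp.
  by move=> /(bd_lt_cat hd) h; apply/(bd_lt_cat hd).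
split.
- split=> [a|a v x|a v x y]; rewrite !TE//= !size_rcons//.
  exact: ltnW.
- split=> [a|a v x /T'P[p /= [pn e pre]]|a v x y /T'P[p /= [pn e pre]]].
  + have [p pn [m mE]] := Qcov a (fun=> x0).
    by apply/T'P; exists p; rewrite mE pn; split=> //; exact: prefix0s.
  + apply/T'P; exists p; split=> //=; move/prefixP: pre => [w ->].
    by rewrite -cats1 -catA prefix_prefix.
  (* A ray through the sibling is covered by some [Q p']. If that word stopped at [v] or above, it
     would be a prefix of [Q p], which passes below [v]; then [p' = p], against the lengths. *)
  + have [p' p'n [m mE]] := Qcov a (ray_cat (rcons v y) (fun=> x0)).
    apply/T'P; exists p'; rewrite mE p'n; split=> //=.
    case: (leqP (size v).+1 m) => vm.
      rewrite -(subnKC vm) -(size_rcons v y) mkseq_ray_cat.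
      exact: prefix_prefix.
    suff pp' : p' = p.
      by move: (size_prefix pre) vm; rewrite -pp' mE /= size_mkseq size_rcons; lia.
    apply: Qpre => //; first by rewrite mE.
    move/prefixP: pre => [w ->]; rewrite mE /=.
    have -> : mkseq (ray_cat (rcons v y) (fun=> x0)) m = take m v.
      apply: (@eq_from_nth _ x0) => [|j]; rewrite size_mkseq.
        rewrite size_take; case: (ltnP m (size v)) => // vm'.
        by apply/eqP; rewrite eqn_leq vm' -ltnS vm.
      move=> jm; have jv : (j < size v)%N := leq_trans jm vm.
      rewrite nth_mkseq// nth_take// (ray_cat_lt _ x0) ?size_rcons 1?ltnW//.
      by rewrite nth_rcons jv.
    by rewrite -cats1 -{2}(cat_take_drop m v) -!catA prefix_prefix.
- split=> [p /leafT pn|p q|p].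
  + by apply/leafT'; exists p.
  + rewrite !inE => /leafT pn /leafT qn e; apply: Qpre => //; first by rewrite e.
    by rewrite e prefix_refl.
  + by move=> /leafT'[p0 p0n ->]; exists p0 => //; apply/leafT.
- by move=> p _; split.
- by move=> p xi /leafT/QP cp; rewrite cp r1.
Qed.

End Thompson.

(** * Prefix replacements and sections *)

Lemma act_eq d (s t : portrait d) u :
  (forall v, (size v < size u)%N -> s v = t v) -> act s u = act t u.
Proof.
elim/last_ind: u => // u x IH st; rewrite !act_rcons IH ?st ?size_rcons// => v vu.
by apply: st; rewrite size_rcons ltnW.
Qed.

Lemma bijM T (f g : bij T) x : (f * g) x = f (g x).
Proof. by []. Qed.

Lemma bijVK T (f : bij T) x : f (f^-1 x) = x.
Proof. exact: bij_invK. Qed.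

Section Assembly.
Variables (k d : nat).
Implicit Types (p q : vertex k d) (xi eta : ray d) (f g : bij (boundary k d)).
Implicit Types (D : {group 'S_d}) (S : vertex k d -> portrait d).

(** The stabilizer of all words of length [n] is a product of groups acting below these words; this
    is its element with components [S p]. Values of [S] at words of another length are never
    read. *)
Definition asm n S : 'I_k -> portrait d :=
  fun a v => if (size v < n)%N then 1 else S (a, take n v) (drop n v).

Lemma triv_asm n S : triv n (asm n S).
Proof. by move=> a v vn; rewrite /asm vn. Qed.

Lemma sec_asm n S p : size p.2 = n -> sec (asm n S p.1) p.2 = S p.
Proof.
case: p => a u /= un; apply/funext => w.
by rewrite /sec /asm size_cat un ltnNge leq_addr /= -un take_size_cat// drop_size_cat.
Qed.

Lemma bact_asm n S p xi : size p.2 = n ->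
  bact (asm n S) (bd_cat p xi) = bd_cat p (ract (S p) xi).
Proof.
by move=> pn; rewrite bact_cat sec_asm// (act_triv _ (@triv_asm n S)) ?pn//; case: p pn.
Qed.

Lemma portraits_in_asm D n S : (forall p, size p.2 = n -> portrait_in D (S p)) -> portraits_in D (asm n S).
Proof.
move=> SD a v; rewrite /asm; case: ltnP => vn; first exact: group1.
by apply: SD; rewrite /= size_takel.
Qed.

Lemma K_asm D n S : (forall p, size p.2 = n -> portrait_in D (S p)) ->
  K D n (bact (asm n S)).
Proof.
by move=> SD; exists (asm n S); split=> //; [exact: portraits_in_asm|exact: triv_asm].
Qed.

Definition trunc n (s : 'I_k -> portrait d) : 'I_k -> portrait d :=
  fun a v => if (size v < n)%N then s a v else 1.

Lemma bact_trunc n s p xi : size p.2 = n ->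
  bact (trunc n s) (bd_cat p xi) = bd_cat (p.1, act (s p.1) p.2) xi.
Proof.
move=> pn; rewrite bact_cat; congr (bd_cat (_, _) _).
  by apply: act_eq => v; rewrite /trunc pn => ->.
rewrite -[RHS]ract_pid; congr ract; apply/funext => w.
by rewrite /sec /trunc size_cat pn ltnNge leq_addr.
Qed.

(** The first factor lies in V ([trunc_HT]) and, for portraits in [D], takes finitely many values
    ([trunc_finite]); peeling it off reduces everything to sections. *)
Lemma bact_trunc_asm n (s : 'I_k -> portrait d) :
  bact s = bact (trunc n s) * bact (asm n (fun p => sec (s p.1) p.2)).
Proof.
apply: (@bij_ext_level _ _ n) => p xi pn.
by rewrite bijM bact_asm// bact_trunc// bact_cat.
Qed.

Lemma K_trunc D n s : portraits_in D s -> K D 0 (bact (trunc n s)).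
Proof.
move=> sD; exists (trunc n s); split=> // a v; rewrite /trunc.
by case: ifP => _; [exact: sD|exact: group1].
Qed.

Lemma trunc_finite D n : exists ys : seq (bij (boundary k d)),
  (forall y, y \in ys -> exists2 s, portraits_in D s & y = bact (trunc n s)) /\
  forall s, portraits_in D s -> bact (trunc n s) \in ys.
Proof.
pose E (F : {ffun 'I_k * n.-bseq 'I_d -> 'S_d}) : 'I_k -> portrait d :=
  fun a v => F (a, insub_bseq n v).
pose good (F : {ffun 'I_k * n.-bseq 'I_d -> 'S_d}) := [forall x, F x \in D].
exists [seq bact (trunc n (E F)) | F <- enum good]; split.
  move=> y /mapP[F]; rewrite mem_enum => /forallP FD ->.
  by exists (E F) => // a v; exact: FD.
move=> s sD.
pose F : {ffun 'I_k * n.-bseq 'I_d -> 'S_d} := [ffun x => s x.1 (val x.2)].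
have -> : trunc n s = trunc n (E F).
  apply/funext => a; apply/funext => v; rewrite /trunc; case: ifP => // vn.
  by rewrite /E ffunE /= /insub_bseq insubdK// -topredE /= ltnW.
apply: map_f; rewrite mem_enum; apply/forallP => x; rewrite ffunE; exact: sD.
Qed.

Lemma K_level_finite D n : exists ys : seq (bij (boundary k d)),
  (forall y, y \in ys -> K D 0 y) /\
  forall f, K D 0 f -> exists2 y, y \in ys & K D n (y^-1 * f).
Proof.
have [ys [ysP ysT]] := trunc_finite D n; exists ys; split.
  by move=> y /ysP[s sD ->]; exact: K_trunc.
move=> f [s [sD _ ->]]; exists (bact (trunc n s)); first exact: ysT.
rewrite (bact_trunc_asm n s) mulKg; apply: K_asm => p _; exact: portrait_in_sec.
Qed.

Lemma bact_asm_inv n S p xi : size p.2 = n ->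
  (bact (asm n S))^-1 (bd_cat p xi) = bd_cat p (ract (pinv (S p)) xi).
Proof.
move=> pn; apply: (can_inj (bij_funK (bact (asm n S)))).
by rewrite bact_asm// ractVK bijVK.
Qed.

Lemma locally_W_choice D n f : locally_W D n f -> exists (Q : vertex k d -> vertex k d) S,
  forall p, size p.2 = n -> portrait_in D (S p) /\
    forall xi, f (bd_cat p xi) = bd_cat (Q p) (ract (S p) xi).
Proof.
move=> fD; have /choice[F FP] : forall p, exists F : vertex k d * portrait d,
    size p.2 = n -> portrait_in D F.2 /\
    forall xi, f (bd_cat p xi) = bd_cat F.1 (ract F.2 xi).
  move=> p; case: (pselect (size p.2 = n)) => [/fD[q [s ?]]|pn].
    by exists (q, s).
  by exists (p, @pid d).
by exists (fst \o F), (snd \o F).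
Qed.

(** On each cone of a deep enough level, [f] is a prefix change after an element of W(D). Undoing
    all these elements first leaves a map that only changes prefixes. *)
Lemma AAutD_decomp D f : (1 < d)%N -> AAutD D f ->
  exists v g, [/\ HT v, K D 0 g & f = v * g].
Proof.
move=> hd /AAutD_loc[n /locally_W_choice[Q [S QS]]].
exists (f * (bact (asm n S))^-1), (bact (asm n S)); split.
- apply: (@locally_replaces_HT _ _ hd n) => p pn; exists (Q p) => xi.
  by rewrite bijM bact_asm_inv// (QS _ pn).2 ractVK.
- by apply: (@K_leq _ _ D 0 n) => //; apply: K_asm => p /QS[].
- by rewrite mulgVK.
Qed.

(** Continuity of conjugation by [g], which need not normalize W_k(D). *)
Lemma conj_K D g : AAutD D g -> forall j, exists i, forall f, K D i f ->
  K D j (g^-1 * f * g).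
Proof.
move=> /AAutD_loc[n /locally_W_choice[Q [S QS]]] j.
(* At this depth [c] fixes every target [Q p] and has trivial local permutations on the first [j]
   levels below it; the latter survives conjugation by [S p]. *)
exists (j + \max_(p <- vertices k d n) size (Q p).2)%N => f [c [cD ct ->]].
pose R p := pcomp (pinv (S p)) (pcomp (sec (c (Q p).1) (Q p).2) (S p)).
have -> : g^-1 * bact c * g = bact (asm n R).
  apply: (@bij_ext_level _ _ n) => p xi pn; rewrite bact_asm//.
  apply: (can_inj (bij_funK g)); rewrite !bijM bijVK !(QS _ pn).2 bact_cat.
  rewrite !ract_pcomp ractVK; set l := size (Q p).2.
  rewrite (act_triv _ ct); first by case: (Q p).
  apply: leq_trans (leq_addl _ _).
  apply: (@leq_bigmax_seq _ _ xpredT (fun p => size (Q p).2)) => //.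
  by rewrite mem_vertices pn.
exists (asm n R); split=> //.
  apply: portraits_in_asm => p /QS[SD _]; apply: portrait_in_pcomp; first exact: portrait_in_pinv.
  apply: portrait_in_pcomp => //; exact: portrait_in_sec.
move=> a v vj; rewrite /asm; case: ltnP => // vn.
set p := (a, take n v); set w := drop n v.
have pn : size p.2 = n by rewrite size_takel.
have wj : (size w < j)%N by rewrite size_drop; lia.
have ct' u : (size u < j)%N -> sec (c (Q p).1) (Q p).2 u = 1.
  move=> uj; apply: ct; rewrite size_cat addnC -addSn.
  apply: leq_add => //; apply: (@leq_bigmax_seq _ _ xpredT (fun p => size (Q p).2)) => //.
  by rewrite mem_vertices pn.
rewrite /R /pcomp ct' ?size_act// mulg1.
rewrite act_pcomp (@act_eq _ (sec (c (Q p).1) (Q p).2) (@pid d)).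
  by rewrite act_pid /pinv actK mulgV.
by move=> u; rewrite size_act => uw; rewrite ct'//; apply: ltn_trans wj.
Qed.

Definition at_ p (t : portrait d) : 'I_k -> portrait d :=
  asm (size p.2) (fun q => if q == p :> 'I_k * seq 'I_d then t else @pid d).

Lemma K_at D p t : portrait_in D t -> K D 0 (bact (at_ p t)).
Proof.
move=> tD; apply: (@K_leq _ _ D 0 (size p.2)) => //; apply: K_asm => q _.
by case: ifP => // _; exact: portrait_in_pid.
Qed.

Lemma bact_at p t xi : bact (at_ p t) (bd_cat p xi) = bd_cat p (ract t xi).
Proof. by rewrite bact_asm// eqxx. Qed.

Lemma bact_at_out p t x : (forall xi, x <> bd_cat p xi) ->
  bact (at_ p t) x = x.
Proof.
have [q [xi [qp ->]]] := bd_cat_split x (size p.2) => qx.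
rewrite bact_asm//; case: eqP => [qE|_]; last by rewrite ract_pid.
by case: (qx xi); rewrite -qE.
Qed.

Lemma at_pid p : bact (at_ p (@pid d)) = 1.
Proof.
apply: (@bij_ext_level _ _ (size p.2)) => q xi qp.
by rewrite bact_asm// if_same ract_pid.
Qed.

(** This is how sections are moved between cones: a prefix replacement does not alter the portrait
    [t], and both sides fix all points outside the cone of [q]. *)
Lemma at_conj z p q t : replaces z p q ->
  bact (at_ q t) = z * bact (at_ p t) * z^-1.
Proof.
move=> zpq; suff e : bact (at_ q t) * z = z * bact (at_ p t) by rewrite -e mulgK.
apply: bij_eq => x; rewrite !bijM.
case: (pselect (exists xi, x = bd_cat p xi)) => [[xi ->]|xp].
  by rewrite zpq !bact_at zpq.
rewrite !bact_at_out// => [xi xE|xi]; first by apply: xp; exists xi.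
by rewrite -zpq => /(can_inj (bij_funK z)) xE; apply: xp; exists xi.
Qed.

Lemma prod_at n (ps : seq ('I_k * seq 'I_d)) S :
  uniq ps -> all (fun p => size p.2 == n) ps ->
  \prod_(p <- ps) bact (at_ p (S p)) =
  bact (asm n (fun p => if p \in ps then S p else @pid d)).
Proof.
move=> + psn; elim: ps psn => [_ _|p ps IH /andP[/eqP pn psn] /andP[pps ups]].
  rewrite big_nil; apply: (@bij_ext_level _ _ n) => q xi qn.
  by rewrite bact_asm// ract_pid.
rewrite big_cons IH//; apply: (@bij_ext_level _ _ n) => q xi qn.
rewrite bijM !bact_asm ?pn// inE; case: eqP => [->|_] /=.
  by rewrite (negbTE pps) ract_pid.
by rewrite ract_pid.
Qed.

Lemma locally_replaces_ge n f p : locally_replaces n f -> (n <= size p.2)%N -> exists q, replaces f p q.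
Proof.
case: p => a u fn /= un; have [|q cq] := fn (a, take n u).
  by rewrite /= size_takel.
exists (q.1, q.2 ++ drop n u) => xi.
by rewrite -{1}(cat_take_drop n u) bd_cat_cat cq bd_cat_cat; case: (q).
Qed.

Lemma trunc_HT n s : (1 < d)%N -> HT (bact (trunc n s)).
Proof.
move=> hd; apply: (@locally_replaces_HT _ _ hd n) => p pn.
by exists (p.1, act (s p.1) p.2) => xi; rewrite bact_trunc.
Qed.

Lemma replaces_mul f g p q r : replaces f q r -> replaces g p q -> replaces (f * g) p r.
Proof. by move=> fqr gpq xi; rewrite [LHS]/= gpq fqr. Qed.

End Assembly.

(** * Elements of V exchanging two disjoint cones *)

Section Swap.
Variables (k d : nat).
Hypothesis hd : (1 < d)%N.
Implicit Types (p q r : vertex k d) (xi eta : ray d) (x : boundary k d).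

Definition in_cone p x : bool :=
  (x.1 == p.1) && (mkseq x.2 (size p.2) == p.2).

Definition ray_tail n x : ray d := fun j => x.2 (n + j)%N.

Lemma in_coneP p x :
  in_cone p x -> x = bd_cat p (ray_tail (size p.2) x).
Proof.
by case: x => a xi /andP[/eqP /= -> /eqP e]; rewrite /bd_cat -{1}e /= ray_cat_mkseq.
Qed.

Lemma in_cone_cat p xi : in_cone p (bd_cat p xi).
Proof. by rewrite /in_cone /= mkseq_ray_cat_size !eqxx. Qed.

Lemma ray_tail_cat p xi : ray_tail (size p.2) (bd_cat p xi) = xi.
Proof.
by apply: (@bd_cat_inj _ _ p); rewrite -in_coneP//; exact: in_cone_cat.
Qed.

Lemma in_cone_deep p r xi : (size p.2 <= size r.2)%N ->
  in_cone p (bd_cat r xi) = (r.1 == p.1) && (take (size p.2) r.2 == p.2).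
Proof.
case: r => b u /= pu; rewrite /in_cone /=.
have := mkseq_ray_cat_size (take (size p.2) u) (ray_cat (drop (size p.2) u) xi).
by rewrite size_takel// -ray_cat_cat cat_take_drop => ->.
Qed.

(** Exchange the two cones and fix everything else. A cone at least as deep as both lies in one of
    them or misses both, so the involution is locally a prefix replacement. *)
Lemma exists_swap p q : (forall xi eta, bd_cat p xi <> bd_cat q eta) ->
  exists2 f, HT f & replaces f p q.
Proof.
move=> pq; pose sw x := if in_cone p x then bd_cat q (ray_tail (size p.2) x)
  else if in_cone q x then bd_cat p (ray_tail (size q.2) x) else x.
have qNp xi : in_cone p (bd_cat q xi) = false.
  by apply/negP => /in_coneP e; apply: pq; symmetry; exact: e.
have swp xi : sw (bd_cat p xi) = bd_cat q xi.
  by rewrite /sw in_cone_cat ray_tail_cat.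
have swq xi : sw (bd_cat q xi) = bd_cat p xi.
  by rewrite /sw qNp in_cone_cat ray_tail_cat.
have swK : involutive sw.
  move=> x; case px : (in_cone p x); first by rewrite (in_coneP px) swp swq.
  case qx : (in_cone q x); first by rewrite (in_coneP qx) swq swp.
  have swx : sw x = x by rewrite /sw px qx.
  by rewrite !swx.
exists (Bij swK swK) => [|xi]; last exact: swp.
apply: (@locally_replaces_HT _ _ hd (maxn (size p.2) (size q.2))) => r rn.
have [pr qr] : (size p.2 <= size r.2)%N /\ (size q.2 <= size r.2)%N.
  by rewrite rn leq_maxl leq_maxr.
have rE r' xi : r.1 = r'.1 -> take (size r'.2) r.2 = r'.2 ->
    bd_cat r xi = bd_cat r' (ray_cat (drop (size r'.2) r.2) xi).
  case: r r' {rn pr qr} => [a u] [b v] /= -> e.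
  by rewrite -bd_cat_cat -{1}e cat_take_drop.
case pP : ((r.1 == p.1) && (take (size p.2) r.2 == p.2)).
  exists (q.1, q.2 ++ drop (size p.2) r.2) => xi /=.
  case/andP: pP => /eqP e1 /eqP e2; rewrite (rE p)// swp bd_cat_cat.
  by case: (q).
case qP : ((r.1 == q.1) && (take (size q.2) r.2 == q.2)).
  exists (p.1, p.2 ++ drop (size q.2) r.2) => xi /=.
  case/andP: qP => /eqP e1 /eqP e2; rewrite (rE q)// swq bd_cat_cat.
  by case: (p).
by exists r => xi /=; rewrite /sw !in_cone_deep// pP qP.
Qed.

End Swap.

(** * Counting vertices at which a map is not a prefix replacement *)

Section BadVertices.
Variables (k d : nat).
Hypothesis hd : (1 < d)%N.
Implicit Types (p q r : vertex k d) (xi eta : ray d) (f g : bij (boundary k d)).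
Implicit Types (B : seq ('I_k * seq 'I_d)).

Let x0 : 'I_d := Ordinal (ltnW hd).
Let x1 : 'I_d := Ordinal hd.

(** [B] is only an upper bound: it may repeat vertices or contain harmless ones, so that sizes
    simply add in products. *)
Definition bad_in f B := forall p, p \notin B -> exists q, replaces f p q.

Lemma HT_bad f : HT f -> exists B, bad_in f B.
Proof.
move=> /(HT_loc hd)[n fn]; exists (vertices k d n) => p.
by rewrite mem_vertices -ltnNge => np; apply: locally_replaces_ge fn (ltnW np).
Qed.

(* A vertex is bad for [f * g] if it is bad for [g] or is sent by [g] to a bad
   vertex of [f], which happens for at most one vertex. *)
Lemma bad_mul f g B C : bad_in f B -> bad_in g C ->
  exists2 E, size E = (size B + size C)%N & bad_in (f * g) E.
Proof.
move=> fB gC; have /choice[h hP] : forall q, exists p,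
    forall p', replaces g p' q -> p' = p.
  move=> q; case: (pselect (exists p, replaces g p q)) => [[p cp]|nop]; last first.
    by exists q => p' cp'; case: nop; exists p'.
  exists p => p' cp'.
  have e xi : bd_cat p' xi = bd_cat p xi.
    by apply: (can_inj (bij_funK g)); rewrite cp cp'.
  (* Vertices with equal cones are equal: the longer word would prescribe the letter after the
     shorter one, while the constant tails [x0] and [x1] give different letters there. *)
  wlog pp' : p p' {cp cp'} e / (size p'.2 <= size p.2)%N => [hw|].
    by case: (leqP (size p'.2) (size p.2)) => [|/ltnW] l; [|symmetry];
      apply: hw => // xi; rewrite e.
  case: (ltngtP (size p'.2) (size p.2)) pp' => // [lt _|eq _]; last first.
    by case: (bd_cat_eq eq (e (fun=> x0))).
  have e0 := congr1 (fun x => x.2 (size p'.2)) (e (fun=> x0)).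
  have e1 := congr1 (fun x => x.2 (size p'.2)) (e (fun=> x1)).
  move: e0 e1; rewrite /= !(ray_cat_lt _ x0 lt) !ray_cat_ge// => <- /eqP.
  by rewrite -val_eqE.
exists (map h B ++ C); first by rewrite size_cat size_map.
move=> p; rewrite mem_cat negb_or => /andP[pB /gC[q cq]].
have /fB[r cr] : q \notin B.
  by apply: contra pB => qB; rewrite (hP _ _ cq); exact: map_f.
by exists r; exact: replaces_mul cr cq.
Qed.

(** A tree automorphism cannot replace a prefix by one of another length: as [d >= 2], two different
    letters would have to agree. Equal lengths force the section to be trivial. *)
Lemma bad_bact (s : 'I_k -> portrait d) B p : bad_in (bact s) B -> p \notin B ->
  sec (s p.1) p.2 = @pid d.
Proof.
move=> sB /sB[q cq]; set t := sec _ _; set u := act (s p.1) p.2.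
have {cq}e xi : ray_cat u (ract t xi) = ray_cat q.2 xi.
  by have := cq xi; rewrite bact_cat => -[].
have x01 : x0 <> x1 by move/(congr1 val).
case: (ltngtP (size u) (size q.2)) => uq.
- have e' x : t [::] x = nth x0 q.2 (size u).
    have := congr1 (fun z => z (size u)) (e (fun=> x)) => /=.
    by rewrite (ray_cat_lt _ x0 uq) ray_cat_ge// subnn.
  by case: x01; apply: (@perm_inj _ (t [::])); rewrite !e'.
- have e' x : x = nth x0 u (size q.2).
    have := congr1 (fun z => z (size q.2)) (e (fun=> x)) => /=.
    by rewrite (ray_cat_lt _ x0 uq) ray_cat_ge.
  by case: x01; rewrite (e' x0) {1}(e' x1).
- apply: ract_inj => xi; rewrite ract_pid.
  by have [] := ray_cat_eq uq (e xi).
Qed.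

End BadVertices.

(** * Compact generation *)

Lemma seq_bound (T : eqType) (P : T -> nat -> Prop) (l : seq T) :
  (forall y m n, (m <= n)%N -> P y m -> P y n) ->
  (forall y, y \in l -> exists n, P y n) ->
  exists n, forall y, y \in l -> P y n.
Proof.
move=> Pmono; elim: l => [|x l IH] lP; first by exists 0.
have [n nP] := IH (fun y yl => lP y (mem_behead (s := x :: l) yl)).
have [m mP] := lP x (mem_head _ _).
exists (maxn m n) => y; rewrite inE => /orP[/eqP ->|/nP yP].
  by apply: Pmono mP; exact: leq_maxl.
by apply: Pmono yP; exact: leq_maxr.
Qed.

Lemma seq_union (T U : eqType) (Q : U -> Prop)
    (R : T -> seq U -> Prop) (l : seq T) :
  (forall y s s', {subset s <= s'} -> R y s -> R y s') ->
  (forall y, y \in l -> exists s, (forall u, u \in s -> Q u) /\ R y s) ->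
  exists s, (forall u, u \in s -> Q u) /\ forall y, y \in l -> R y s.
Proof.
move=> Rmono; elim: l => [|x l IH] lP; first by exists [::].
have [s [sQ sR]] := IH (fun y yl => lP y (mem_behead (s := x :: l) yl)).
have [s' [s'Q s'R]] := lP x (mem_head _ _).
exists (s' ++ s); split=> [u|y].
  by rewrite mem_cat => /orP[/s'Q|/sQ].
rewrite inE => /orP[/eqP ->|/sR yR].
  by apply: Rmono s'R => u us; rewrite mem_cat us.
by apply: Rmono yR => u us; rewrite mem_cat us orbT.
Qed.

(* Finite lists of indices, ordered by inclusion, index the filter to which
   [near_covering] is applied. *)
Lemma compact_subcover (T : topologicalType) (I : eqType) (A : set T)
    (U : I -> set T) :
  compact A -> (forall x, A x -> exists i, nbhs x (U i)) ->
  exists l : seq I, forall x, A x -> exists2 i, i \in l & U i x.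
Proof.
move=> /compact_near_coveringP Ac AU.
pose F : set_system (seq I) := [set B | exists l0 : seq I,
  forall l : seq I, {subset l0 <= l} -> B l].
have FF : Filter F.
  split=> [|B C [lB BP] [lC CP]|B C BC [l lP]].
  - by exists [::].
  - exists (lB ++ lC) => l sl; split; [apply: BP|apply: CP] => x xl;
      by apply: sl; rewrite mem_cat xl ?orbT.
  - by exists l => l' /lP/BC.
have [x /AU[i Ui]|l lP] :=
    Ac (seq I) F (fun l x => exists2 i, i \in l & U i x) FF.
  exists (U i, [set l : seq I | i \in l]); last first.
    by move=> [y l] [/= Uy il]; exists i.
  by split=> //=; exists [:: i] => l; apply; rewrite mem_head.
by exists l => x /(lP l (fun _ => id)).
Qed.

Section CompactGeneration.
Variables (k d : nat) (D : {group 'S_d}).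
Hypothesis hd : (1 < d)%N.
Local Notation G := (AAutD_group k D).
Local Notation i := (@AAutD_val k d D).
Variable S : set G.
Hypothesis Scompact : compact S.
Hypothesis Ggen : range (@word_eval (bij (boundary k d)) G i S) = range i.
Implicit Types (w : word S) (f g : bij (boundary k d)) (x : G).

Local Notation ev := (@word_eval (bij (boundary k d)) G i S).
Local Notation AA := (@AAutD k d D).
Local Notation Kn := (@K k d D).

Lemma range_AAutD : range i = AA.
Proof.
apply/seteqP; split=> [_ [x _ <-]|f fA].
  by have := valP x; rewrite inE.
by exists (exist _ f (mem_set fA)).
Qed.

Lemma AA_val x : AA (i x).
Proof. by rewrite -range_AAutD; exists x. Qed.

Lemma AA_ev w : AA (ev w).
Proof. by rewrite -range_AAutD -Ggen; exists w. Qed.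

Lemma AA_word f : AA f -> exists w, ev w = f.
Proof. by rewrite -range_AAutD -Ggen => -[w _ <-]; exists w. Qed.

Lemma AAM f g : AA f -> AA g -> AA (f * g).
Proof.
move=> /AA_word[v <-] /AA_word[w <-]; rewrite -word_eval_cat; exact: AA_ev.
Qed.

Lemma AAV f : AA f -> AA f^-1.
Proof. move=> /AA_word[v <-]; rewrite -word_eval_inv; exact: AA_ev. Qed.

Lemma AAK n f : Kn n f -> AA f.
Proof.
move=> [s [sD _ ->]].
have T0 (p : 'I_k * seq 'I_d) : p \in [fset (a, [::]) | a in 'I_k]%fset <->
    p.2 = [::].
  split=> [/imfsetP[a _ ->]//|]; case: p => a v /= ->.
  by apply/imfsetP; exists a.
pose T := [fset (a, ([::] : seq 'I_d)) | a in 'I_k]%fset.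
have Tc : complete_subtree T.
  by split=> [a|a v x|a v x y]; [exact/T0|move/T0; case: v|move/T0; case: v].
have lT p : leaf T p <-> p.2 = [::].
  split=> [[/T0]//|pT]; split=> [|x]; first exact/T0.
  by apply/negP => /T0; case: (p.2).
exists T, T, id, (fun p => act_bij (s p.1)); split; last first.
  by move=> p _; apply/WP; exists (s p.1) => //; exact: sD.
split=> //.
- by split=> // p lp; exists p.
- move=> p _; exact: (@tree_aut_act _ (s p.1)).
- move=> p xi /lT; case: p => a v /= ->.
  by rewrite /bd_cat /= !ray_cat0 (@ray_act_ract _ (s a)).
Qed.

Lemma K_conj g : AA g -> forall j, exists n, forall f, Kn n f ->
  Kn j (g * f * g^-1).
Proof.
move=> gA j; have [n nP] := conj_K (AAV gA) j.
by exists n => f /nP; rewrite invgK.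
Qed.

Lemma open_coset x n : open [set y : G | Kn n ((i x)^-1 * i y)].
Proof.
move=> y /= xy; exists n => z /Wk_stabE yz; rewrite /=.
have -> : (i x)^-1 * i z = ((i x)^-1 * i y) * ((i y)^-1 * i z).
  by rewrite mulgA mulgK.
by apply: KM; [exact: xy|exact: yz].
Qed.

Lemma compact_cosets : exists ys : seq (bij (boundary k d)),
  (forall y, y \in ys -> AA y) /\
  forall x, S x -> exists2 y, y \in ys & Kn 0 (y^-1 * i x).
Proof.
have [|l lP] := @compact_subcover G G S
    (fun x => [set y : G | Kn 0 ((i x)^-1 * i y)]) Scompact.
  move=> x _; exists x; apply: open_nbhs_nbhs; split; first exact: open_coset.
  by rewrite /= mulVg; exact: K1.
exists [seq i x | x <- l]; split.
  by move=> y /mapP[x _ ->]; exact: AA_val.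
by move=> x /lP[y yl xy]; exists (i y) => //; exact: map_f.
Qed.

Lemma compact_cluster (s : nat -> G) : (forall n, S (s n)) ->
  exists2 x, S x & forall n, exists2 j, (n <= j)%N & Kn n ((i x)^-1 * i (s j)).
Proof.
move=> sS; have [|x [Sx xc]] := Scompact (F := s @ \oo).
  by exists 0 => // n _; exact: sS.
exists x => // n.
have [] := xc (s @` [set j | (n <= j)%N]) [set y : G | Kn n ((i x)^-1 * i y)].
- by exists n => // j /= nj; exists j.
- apply: open_nbhs_nbhs; split; first exact: open_coset.
  by rewrite /= mulVg; exact: K1.
- by move=> _ [[j nj <-] xs]; exists j.
Qed.

(** With length exactly [n] the balls need not be nested; the Baire argument uses that they are
    closed, countably many, and cover the group. *)
Definition ball n : set (bij (boundary k d)) :=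
  [set f | exists2 w, size w = n & ev w = f].

Lemma ev_rcons w (l : S * bool) : ev (rcons w l) =
  ev w * (if l.2 then (i (val l.1))^-1 else i (val l.1)).
Proof.
rewrite -cats1 word_eval_cat; congr (_ * _).
by rewrite /word_eval big_seq1.
Qed.

(** Induction on [n]: the last letters of the approximating words cluster at some [x] in [S].
    Removing [x] leaves an element approximated by shorter words, because conjugation by a fixed
    letter is continuous. *)
Lemma ball_closed n f : AA f ->
  (forall j, exists2 g, Kn j g & ball n (f * g)) -> ball n f.
Proof.
elim: n f => [|n IH] f fA fP.
  have f1 j : Kn j f.
    have [g gK [w /size0nil ->]] := fP j; rewrite word_eval_nil => e.
    by rewrite -[f](mulgK g) -e mul1g; exact: KV.
  have [s [sD _ fE]] := f1 0.
  suff -> : f = 1 by exists [::] => //; exact: word_eval_nil.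
  rewrite fE -bact1; congr bact; apply/funext => a; apply/funext => v.
  have [t [_ tt fE']] := f1 (size v).+1.
  have /bact_inj -> : bact s = bact t by rewrite -fE -fE'.
  by rewrite tt.
pose letter x (b : bool) := if b then (i x)^-1 else i x.
have letterA x b : AA (letter x b).
  by case: b; [apply: AAV; exact: AA_val|exact: AA_val].
(* One sign serves all [j]: if both failed, at [j1] and [j2], an approximation at level [maxn j1 j2]
   would contradict one of the failures. *)
have [b bP] : exists b, forall j, exists g, Kn j g /\
    exists x, S x /\ ball n (f * g * (letter x b)^-1).
  apply: contrapT => /forallNP nb.
  have /existsNP[j1 j1P] := nb true; have /existsNP[j2 j2P] := nb false.
  have [g gK [w]] := fP (maxn j1 j2).
  case/lastP: w => // w [x b]; rewrite size_rcons => -[wn].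
  rewrite ev_rcons -[X in _ * X]/(letter (val x) b) => e.
  have bg : ball n (f * g * (letter (val x) b)^-1).
    by exists w => //; rewrite -e mulgK.
  have Sx : S (val x) by have := valP x; rewrite inE.
  case: b bg {e} => bg; [apply: j1P|apply: j2P]; exists g; split.
  - by apply: K_leq gK; exact: leq_maxl.
  - by exists (val x).
  - by apply: K_leq gK; exact: leq_maxr.
  - by exists (val x).
have /choice[gs gsP] := bP.
have /choice[xs xsP] : forall j, exists x, S x /\ ball n (f * gs j * (letter x b)^-1).
  by move=> j; exact: (gsP j).2.
have [x Sx xc] := compact_cluster (fun j => (xsP j).1).
suff [w wn we] : ball n (f * (letter x b)^-1).
  exists (rcons w (exist _ x (mem_set Sx), b)); first by rewrite size_rcons wn.
  rewrite ev_rcons we -[X in _ * X]/(letter x b); by rewrite mulgKV.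
apply: IH => [|l]; first by apply: AAM => //; apply: AAV.
have [n1 n1P] : exists n1, forall g, Kn n1 g -> Kn l (letter x b * g * (letter x b)^-1).
  exact: K_conj.
have [j jn xj] := xc (maxn n1 l).
have gK1 : Kn n1 (gs j).
  by apply: K_leq (gsP j).1; apply: leq_trans jn; exact: leq_maxl.
have [h xsE {}xj] : exists2 h, i (xs j) = i x * h & Kn (maxn n1 l) h.
  by exists ((i x)^-1 * i (xs j)); rewrite ?mulKVg.
exists (letter x b * (gs j * (letter (xs j) b)^-1)); last first.
  have := (xsP j).2; rewrite -!mulgA; by rewrite mulKg.
rewrite /letter xsE /=; case: b {bP gsP xsP letterA} n1P => n1P /=.
  rewrite invgK !mulgA; apply: KM; last by apply: K_leq xj; exact: leq_maxr.
  by have := n1P _ gK1; rewrite /letter invgK.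
rewrite invgM !mulgA -[_ * h^-1]mulgA; apply: n1P; apply: KM => //.
by apply: KV; apply: K_leq xj; exact: leq_maxl.
Qed.

Lemma K_coset (s t : 'I_k -> portrait d) n : portraits_in D s -> portraits_in D t ->
  Kn n ((bact s)^-1 * bact t) <->
  forall a v, (size v < n)%N -> s a v = t a v.
Proof.
move=> sD tD; split=> [[c [cD ct cE]] a v vn|st].
  have /bact_inj -> : bact t = bact (fun a => pcomp (s a) (c a)).
    by rewrite -bactM -cE mulKVg.
  by rewrite /pcomp ct// mul1g (act_triv _ ct)// ltnW.
exists (fun a => pcomp (pinv (s a)) (t a)); split; last by rewrite bactV bactM.
  by move=> a; apply: portrait_in_pcomp => //; exact: portrait_in_pinv.
move=> a v vn; rewrite /pcomp -(@act_eq _ (s a)); last first.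
  by move=> u uv; apply: st; exact: ltn_trans vn.
by rewrite /pinv actK st// mulgV.
Qed.

(** The local permutation of the limit at [v] is that of [F (size v).+1]: later terms do not change
    it, since [J] at this index exceeds [size v]. *)
Lemma K_complete (F : nat -> bij (boundary k d)) (J : nat -> nat) :
  (forall n, Kn 0 (F n)) -> (forall n, (n <= J n)%N) ->
  (forall m n, (m <= n)%N -> Kn (J m) ((F m)^-1 * F n)) ->
  exists f, forall n, Kn (J n) ((F n)^-1 * f).
Proof.
move=> FK nJ FF; have /choice[s sP] : forall n, exists s, portraits_in D s /\ F n = bact s.
  by move=> n; have [s [sD _ ->]] := FK n; exists s.
pose t a v := s (size v).+1 a v.
have tD : portraits_in D t by move=> a v; exact: (sP _).1.
exists (bact t) => n; rewrite (sP n).2; apply/K_coset => //; first exact: (sP n).1.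
move=> a v vn; rewrite /t; case: (leqP n (size v).+1) => nv.
  have := FF _ _ nv; rewrite !(sP _).2 K_coset; [exact|exact: (sP _).1|exact: (sP _).1].
have := FF _ _ (ltnW nv); rewrite !(sP _).2 K_coset; [|exact: (sP _).1|exact: (sP _).1].
by move=> ->//; exact: leq_trans (nJ _).
Qed.

(* Baire category: the closed sets [ball n] cover [K 0]. *)
Lemma ball_coset : exists n f j, Kn 0 f /\ forall g, Kn j g -> ball n (f * g).
Proof.
apply: contrapT => noball.
(* A coset [x.1 * K x.2] is shrunk until it misses [ball n]: by assumption it is not contained in
   the ball, and closedness gives a point outside a whole neighbourhood outside. *)
have step (x : bij (boundary k d) * nat) n : exists y, Kn 0 x.1 ->
    [/\ Kn x.2 (x.1^-1 * y.1), (x.2 < y.2)%N &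
      forall h, Kn y.2 h -> ~ ball n (y.1 * h)].
  case: (pselect (Kn 0 x.1)) => [xK|?]; last by exists x.
  have [g gK gN] : exists2 g, Kn x.2 g & ~ ball n (x.1 * g).
    apply: contrapT => H; apply: noball; exists n, x.1, x.2; split=> // g gK.
    by apply: contrapT => gN; apply: H; exists g.
  have gA : AA (x.1 * g) by apply: AAM; [exact: AAK xK|exact: AAK gK].
  have [j jP] : exists j, forall h, Kn j h -> ~ ball n (x.1 * g * h).
    apply: contrapT => /forallNP H; apply: gN; apply: ball_closed => // j.
    have /existsNP[h /not_implyP[hK /contrapT hb]] := H j; by exists h.
  exists (x.1 * g, maxn x.2.+1 j) => _; split=> /=.
  - by rewrite mulKg.
  - exact: leq_maxl.
  - move=> h hK; apply: jP; apply: K_leq hK; exact: leq_maxr.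
have /choice[nxt nxtP] : forall x : (bij (boundary k d) * nat) * nat,
    exists y, Kn 0 x.1.1 ->
    [/\ Kn x.1.2 (x.1.1^-1 * y.1), (x.1.2 < y.2)%N &
      forall h, Kn y.2 h -> ~ ball x.2 (y.1 * h)].
  by move=> [x n]; exact: step.
pose F := fix F n := if n is n'.+1 then nxt (F n', n') else (1, 0%N).
have FK n : Kn 0 (F n).1.
  elim: n => [|n IH]; first exact: K1.
  have [h _ _] := nxtP (F n, n) IH.
  rewrite -(mulKVg (F n).1 (F n.+1).1); apply: KM => //.
  exact: (@K_leq _ _ D 0 (F n).2).
have Fstep n := nxtP (F n, n) (FK n).
have nF n : (n <= (F n).2)%N.
  by elim: n => // n IH; have [_ h _] := Fstep n; exact: leq_ltn_trans IH h.
have Fmono m n : (m <= n)%N -> ((F m).2 <= (F n).2)%N.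
  move=> /subnKC <-; elim: (n - m)%N => [|j IH]; first by rewrite addn0.
  rewrite addnS; have [_ /ltnW h _] := Fstep (m + j)%N; exact: leq_trans h.
have FF m n : (m <= n)%N -> Kn (F m).2 ((F m).1^-1 * (F n).1).
  move=> /subnKC <-; elim: (n - m)%N => [|j IH].
    by rewrite addn0 mulVg; exact: K1.
  rewrite addnS -(mulKVg (F (m + j)%N).1 (F (m + j).+1).1) mulgA.
  apply: KM => //; have [h _ _] := Fstep (m + j)%N; apply: K_leq h.
  exact/Fmono/leq_addr.
have [f fP] := @K_complete (fst \o F) (snd \o F) FK nF FF.
have fA : AA f.
  rewrite -(mulKVg (F 0).1 f); apply: AAM; first exact: AAK (FK 0).
  exact: AAK (fP 0).
(* The limit lies in every chosen coset, hence in no ball, yet it is the value of a word [w]. *)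
have [w wE] := AA_word fA; have [_ _ /(_ _ (fP (size w).+1))] := Fstep (size w).
by apply; exists w => //; rewrite wE [RHS]mulKVg.
Qed.

(** [K 0] is a finite union of cosets [y * K j], and each is the translate by [y * f^-1] of the
    coset from [ball_coset]; only finitely many translations have to be written as words. *)
Lemma K_bounded : exists L, forall f, Kn 0 f -> exists2 w, (size w <= L)%N & ev w = f.
Proof.
have [n [f [j [fK fP]]]] := ball_coset.
have [ys [ysK ysP]] := @K_level_finite k d D j.
have [M MP] : exists M, forall y, y \in ys ->
    exists2 w, (size w <= M)%N & ev w = y * f^-1.
  apply: seq_bound => [y a b ab [w wa wE]|y /ysK yK].
    by exists w => //; exact: leq_trans ab.
  have [|w wE] := @AA_word (y * f^-1); last by exists (size w), w.
  by apply: AAM; [exact: AAK yK|apply: AAV; exact: AAK fK].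
exists (M + n)%N => g /ysP[y /MP[w wM wE] /fP[w' w'n w'E]].
exists (w ++ w'); first by rewrite size_cat w'n leq_add2r.
by rewrite word_eval_cat wE w'E mulgA mulgKV mulKVg.
Qed.

(** If [g^-1 * K n * g] lies in [K 0], the coset of [f * g] modulo [K 0] depends only on that of [f]
    modulo [K n]. Finitely many representatives [y] suffice, and each [y * g] is split by
    [AAutD_decomp]. *)
Lemma K_coset_cover g : AA g -> exists vs : seq (bij (boundary k d)),
  (forall v, v \in vs -> HT v) /\
  forall f, Kn 0 f -> exists2 v, v \in vs & Kn 0 (v^-1 * (f * g)).
Proof.
move=> gA; have [n nP] := conj_K gA 0.
have [ys [ysK ysP]] := @K_level_finite k d D n.
have [||vs [vsH vsP]] := @seq_union _ _
    (@HT k d) (fun y vs => exists2 v, v \in vs & Kn 0 (v^-1 * (y * g))) ys.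
- by move=> y s s' ss' [v vs vK]; exists v => //; exact: ss'.
- move=> y /ysK yK; have [|v [h [vH hK e]]] := @AAutD_decomp _ _ D (y * g) hd.
    by apply: AAM => //; exact: AAK yK.
  exists [:: v]; split=> [u|]; first by rewrite inE => /eqP ->.
  by exists v; rewrite ?mem_head// e mulKg.
exists vs; split=> // f /ysP[y /vsP[v vvs vK] yf]; exists v => //.
have -> : v^-1 * (f * g) = (v^-1 * (y * g)) * (g^-1 * (y^-1 * f) * g).
  by rewrite -!mulgA !mulKVg.
by apply: KM => //; exact: nP.
Qed.

Lemma letter_cover : exists vs : seq (bij (boundary k d)),
  (forall v, v \in vs -> HT v) /\
  forall f x (b : bool), Kn 0 f -> S x ->
    exists2 v, v \in vs & Kn 0 (v^-1 * (f * (if b then (i x)^-1 else i x))).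
Proof.
have [ys [ysA ysP]] := compact_cosets.
have [||vs [vsH vsP]] := @seq_union (bij (boundary k d)) _ (@HT k d)
  (fun y vs => forall f (b : bool), Kn 0 f -> exists2 v, v \in vs &
     Kn 0 (v^-1 * (f * (if b then y^-1 else y)))) ys.
- by move=> y s s' ss' h f b /(h f b)[v /ss' ? ?]; exists v.
- move=> y /ysA yA; have [vs [vsH vsP]] := K_coset_cover yA.
  have [vs' [vsH' vsP']] := K_coset_cover (AAV yA).
  exists (vs ++ vs'); split=> [v|f [] fK].
  + by rewrite mem_cat => /orP[/vsH|/vsH'].
  + by have [v vv vK] := vsP' f fK; exists v => //; rewrite mem_cat vv orbT.
  + by have [v vv vK] := vsP f fK; exists v => //; rewrite mem_cat vv.
exists vs; split=> // f x b fK /ysP[y /vsP yP yx]; case: b.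
  (* Writing the letter as [y * h] with [h] in K, its inverse is [h^-1 * y^-1], and [h^-1] is
     absorbed into [f]. *)
  have [v vv vK] := yP (f * (y^-1 * i x)^-1) true (KM fK (KV yx)).
  by exists v => //; move: vK; rewrite invgM invgK -!mulgA mulgV mulg1.
have [v vv vK] := yP f false fK; exists v => //.
have -> : v^-1 * (f * i x) = (v^-1 * (f * y)) * (y^-1 * i x).
  by rewrite -!mulgA mulKVg.
exact: KM.
Qed.

End CompactGeneration.

(** * Comparison with the Higman-Thompson group *)

Lemma filling_bigcat (gT : groupType) (T : Type) (i : T -> gT) (S : set T) m
    N M (F : 'I_N -> word S) :
  (forall j, filling i m (F j) M) ->
  filling i m (\big[cat/[::]]_(j < N) F j) (N * M).
Proof.
elim: N F => [|N IH] F FM.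
  by rewrite big_ord0; apply: filling0; exact: free_refl.
by rewrite big_ord_recl mulSn; apply: filling_cat => //; exact: IH.
Qed.

Section Comparison.
Variables (k d : nat) (D : {group 'S_d}).
Hypothesis hk : (0 < k)%N.
Hypothesis hd : (1 < d)%N.
Local Notation G := (AAutD_group k D).
Local Notation V := (V_group k d).
Local Notation bd := (bij (boundary k d)).
Local Notation iA := (@AAutD_val k d D).
Local Notation iV := (@V_val k d).
Local Notation AA := (@AAutD k d D).
Local Notation Kn := (@K k d D).
Implicit Types (f g : bd).

Variables (S : set G) (m : nat) (delta : nat -> nat).
Hypothesis Scompact : compact S.
Hypothesis Spres : presented iA S m.
Hypothesis Sdehn : forall n, supremums (areas iA S m n) (delta n).

Variables (SV : set V) (mV : nat) (deltaV : nat -> nat).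
Hypothesis SVpres : presented iV SV mV.
Hypothesis SVdehn : forall n, supremums (areas iV SV mV n) (deltaV n).

Local Notation evA := (@word_eval bd G iA S).
Local Notation evV := (@word_eval bd V iV SV).
Local Notation homotopic := (@homotopic bd G iA S m).

Variable rho : bd -> word S.
Hypothesis rhoE : forall f, AA f -> evA (rho f) = f.
Variables L LV : nat.
Hypothesis rhoK : forall f, Kn 0 f -> (size (rho f) <= L)%N.
Hypothesis rhoV : forall x, SV x -> (size (rho (iV x)) <= LV)%N.

Let Ggen : range evA = range iA := Spres.1.

Lemma range_HT : range iV = HT (k := k) (d := d).
Proof.
apply/seteqP; split=> [_ [x _ <-]|f fV].
  by have := valP x; rewrite inE.
by exists (exist _ f (mem_set fV)).
Qed.

Lemma HT_subgroup : subgroup (@HT k d).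
Proof. by rewrite -range_HT; exact: presented_subgroup SVpres. Qed.

Lemma HT_word f : HT f -> exists w, evV w = f.
Proof. by rewrite -range_HT -SVpres.1 => -[w _ <-]; exists w. Qed.

Lemma HTM f g : HT f -> HT g -> HT (f * g).
Proof. by have [_ + _] := HT_subgroup; exact. Qed.

Lemma rho_HT f : HT f -> evA (rho f) = f.
Proof. by move=> fV; apply: rhoE; exact: HT_AAutD. Qed.

Lemma rho_K n f : Kn n f -> evA (rho f) = f.
Proof. by move=> fK; apply: rhoE; exact: AAK fK. Qed.

Definition subst_letter (x : SV * bool) : word S :=
  if x.2 then word_inv (rho (iV (val x.1))) else rho (iV (val x.1)).

Definition subst (w : word SV) : word S := flatten (map subst_letter w).

Lemma subst_cat v w : subst (v ++ w) = subst v ++ subst w.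
Proof. by rewrite /subst map_cat flatten_cat. Qed.

Lemma subst1 x : subst [:: x] = subst_letter x.
Proof. exact: cats0. Qed.

Lemma subst_inv w : subst (word_inv w) = word_inv (subst w).
Proof.
elim: w => // -[x b] w IH; rewrite -cat1s word_inv_cat !subst_cat IH.
rewrite word_inv_cat; congr (_ ++ _); rewrite !subst1 /subst_letter /=.
by case: b => //=; rewrite word_invK.
Qed.

Lemma ev_subst w : evA (subst w) = evV w.
Proof.
elim: w => [|[x b] w IH]; first by rewrite !word_eval_nil.
rewrite -cat1s subst_cat subst1 !word_eval_cat IH; congr (_ * _).
have xV : HT (iV (val x)) by rewrite -range_HT; exists (val x).
have -> : evV [:: (x, b)] = if b then (iV (val x))^-1 else iV (val x).
  by rewrite /word_eval big_seq1.
rewrite /subst_letter.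
by case: b; rewrite /= ?word_eval_inv rho_HT.
Qed.

Lemma size_subst w : (size (subst w) <= LV * size w)%N.
Proof.
elim: w => // -[x b] w IH; rewrite -cat1s subst_cat subst1 size_cat mulnS leq_add//.
rewrite /subst_letter /=.
have xS : SV (val x) by have := valP x; rewrite inE.
by case: b; rewrite /= ?size_word_inv; exact: rhoV.
Qed.

Lemma subst_free_eq v w : free_eq v w -> free_eq (subst v) (subst w).
Proof.
elim=> {v w} [w|v w _|u v w _ IH1 _ IH2|u v x b].
- exact: free_refl.
- exact: free_sym.
- exact: free_trans IH1 IH2.
- rewrite -cat1s -[_ :: v]cat1s !subst_cat.
  have -> : subst [:: (x, ~~ b)] = word_inv (subst [:: (x, b)]).
    by rewrite -subst_inv.
  have := free_eq_ctx (subst u) (subst v) (free_eqV (subst [:: (x, b)])).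
  by rewrite -!catA.
Qed.

Lemma subst_bigcat N (F : 'I_N -> word SV) :
  subst (\big[cat/[::]]_(j < N) F j) = \big[cat/[::]]_(j < N) subst (F j).
Proof. by apply: (big_morph subst) => // u v; rewrite subst_cat. Qed.

(** A relator of V of length at most [mV] becomes a relation of length at most [LV * mV], so each of
    its conjugates costs a constant in G. *)
Lemma filling_subst w N :
  filling iV mV w N -> filling iA m (subst w) (N * delta (LV * mV)).
Proof.
move=> [u [r [b [rP /subst_free_eq wE]]]]; apply: filling_free_eq wE _.
rewrite subst_bigcat; apply: filling_bigcat => j; have [rs re] := rP j.
have fr : filling iA m (subst (r j)) (delta (LV * mV)).
  apply: (filling_dehn Spres Sdehn); split; last by rewrite ev_subst.
  by apply: leq_trans (size_subst _) _; rewrite leq_mul2l rs orbT.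
rewrite !subst_cat subst_inv; apply: filling_conj.
by case: (b j) => //; rewrite subst_inv; exact: filling_inv.
Qed.

Let dehn n v w := @homotopic_dehn _ _ _ _ _ _ Spres Sdehn n v w.

(** One number bounds both the length of a word in the generators of V and the cost of reaching it,
    which keeps the bookkeeping additive. *)
Definition V_reducible (w : word S) N :=
  exists2 u, (size u <= N)%N & homotopic N w (subst u).

Lemma V_reducible_leq w M N : (M <= N)%N -> V_reducible w M -> V_reducible w N.
Proof.
move=> MN [u us wu]; exists u; first exact: leq_trans us MN.
exact: homotopic_leq wu.
Qed.

Lemma V_reducible_cat v w M N : V_reducible v M -> V_reducible w N -> V_reducible (v ++ w) (M + N).
Proof.
move=> [u us vu] [u' us' wu']; exists (u ++ u').
  by rewrite size_cat leq_add.
by rewrite subst_cat; exact: homotopic_cat.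
Qed.

Lemma V_reducible_inv w N : V_reducible w N -> V_reducible (word_inv w) N.
Proof.
move=> [u us wu]; exists (word_inv u); first by rewrite size_word_inv.
by rewrite subst_inv; exact: homotopic_inv.
Qed.

Lemma V_reducible_homotopic v w M N : homotopic M v w -> V_reducible w N -> V_reducible v (M + N).
Proof.
move=> vw [u us wu]; exists u; first exact: leq_trans us (leq_addl _ _).
exact: homotopic_trans vw wu.
Qed.

Lemma V_reducible_nil : V_reducible [::] 0.
Proof. by exists [::] => //; exact: homotopic_refl. Qed.

Lemma V_reducible_flatten (T : Type) (l : seq T) (W : T -> word S) (N : T -> nat) :
  (forall x, V_reducible (W x) (N x)) ->
  V_reducible (flatten (map W l)) (\sum_(x <- l) N x).
Proof.
move=> WN; elim: l => [|x l IH]; first by rewrite big_nil; exact: V_reducible_nil.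
by rewrite big_cons; exact: V_reducible_cat.
Qed.

(** Applied only to finitely many fixed elements of V, whose uncontrolled bounds then become
    constants. *)
Lemma V_reducible_HT f : HT f -> exists N, V_reducible (rho f) N.
Proof.
move=> fV; have [u uE] := HT_word fV.
exists (maxn (size u) (delta (size (rho f) + size (subst u)))), u.
  exact: leq_maxl.
apply: homotopic_leq (leq_maxr _ _) _; apply: dehn => //.
by rewrite ev_subst uE rho_HT.
Qed.

Lemma V_reducible_HT_seq (vs : seq bd) : (forall v, v \in vs -> HT v) ->
  exists N, forall v, v \in vs -> V_reducible (rho v) N /\ (size (rho v) <= N)%N.
Proof.
move=> vsH; apply: (seq_bound (P := fun v N => V_reducible (rho v) N /\ (size (rho v) <= N)%N)).
  by move=> v a b ab [vn vs']; split; [exact: V_reducible_leq vn|exact: leq_trans vs' ab].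
move=> v /vsH/V_reducible_HT[N vN]; exists (maxn N (size (rho v))).
by split; [apply: V_reducible_leq vN; exact: leq_maxl|exact: leq_maxr].
Qed.

(* Pushing the factors in [K 0] to the right through each letter. *)
Lemma push_K : exists (vs : seq bd) C, (forall v, v \in vs -> HT v) /\
  forall w, exists (l : seq bd) f, [/\ {subset l <= vs}, size l = size w, Kn 0 f &
    homotopic (C * (size w).+1) w (flatten (map rho l) ++ rho f)].
Proof.
have [vs [vsH vsP]] := letter_cover hd Scompact Ggen.
have [N vsN] := V_reducible_HT_seq vsH.
(* The word [rho f] and one letter are exchanged for [rho v] and [rho g]; the four pieces have
   lengths at most [L], 1, [N] and [L]. *)
exists vs, (delta (L + 1 + (N + L)))%N; split=> // w.
set c := delta _; elim/last_ind: w => [|w x [l [f [lvs lw fK wE]]]].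
  exists [::], 1; split=> //; first exact: K1.
  have c0 : (delta L <= c)%N by apply: (dehn_mono Sdehn); lia.
  rewrite /= muln1; apply: homotopic_leq c0 _; apply: dehn.
    by apply: rhoK; exact: K1.
  by rewrite word_eval_nil (@rho_K 0)//; exact: K1.
have xS : S (val x.1) by have := valP x.1; rewrite inE.
have [v vvs vK] := vsP f (val x.1) x.2 fK xS; set g := _ * _ in vK.
exists (rcons l v), g; split=> //.
- by move=> u; rewrite mem_rcons inE => /orP[/eqP ->|/lvs].
- by rewrite !size_rcons lw.
rewrite size_rcons mulnS addnC map_rcons flatten_rcons -!catA -cats1.
have := homotopic_cat wE (homotopic_refl iA m [:: x]); rewrite addn0 => /homotopic_trans; apply.
rewrite -[c]add0n -catA; apply: homotopic_cat; first exact: homotopic_refl.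
apply: dehn.
  have := rhoK fK; have := rhoK vK; have := (vsN _ vvs).2.
  rewrite !size_cat /=; lia.
rewrite !word_eval_cat (rho_K fK) (rho_K vK) rho_HT; last exact: vsH.
by rewrite /g mulKVg /word_eval big_seq1.
Qed.

(** * Transport of sections to one fixed cone *)

Let a0 : 'I_k := Ordinal hk.
Let x0 : 'I_d := Ordinal (ltnW hd).
Let x1 : 'I_d := Ordinal hd.
(** The cone is taken one level below the children of the root: for [k = 1] the cone of [(a0, [::])]
    is the whole boundary and cannot be mapped onto a smaller cone. *)
Let c : vertex k d := (a0, [:: x0]).

Let zoom_vertex p : size p.2 = 1%N -> exists2 z, HT z & replaces z c p.
Proof.
move=> p1; case: (eqVneq (p : 'I_k * seq 'I_d) c) => [->|pc].
  by exists 1 => //; have [] := HT_subgroup.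
apply: (exists_swap hd) => xi eta /bd_cat_eq[|e _]; first by rewrite p1.
by rewrite e eqxx in pc.
Qed.

(** Swaps need disjoint cones, but a child cone lies inside that of [c]; the passage goes through
    [(a0, [:: x1])], whose cone is disjoint from both. *)
Let zoom_child x : exists z, HT z /\ replaces z c (a0, [:: x0; x]).
Proof.
have x01 : x0 <> x1 by move/(congr1 val).
have [|f fV cf] := @exists_swap _ _ hd c (a0, [:: x1]).
  by move=> xi eta /bd_cat_eq[]// [].
have [|g gV cg] := @exists_swap _ _ hd (a0, [:: x1]) (a0, [:: x0; x]).
  by move=> xi eta /(congr1 (fun z => z.2 0%N)) /esym /x01.
exists (g * f); split; first exact: HTM.
exact: replaces_mul cg cf.
Qed.

Lemma sum_count_children (B : seq (seq 'I_d)) :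
  (\sum_(x : 'I_d) count (fun u => ohead u == Some x) B)%N =
  count (fun u => u != [::]) B.
Proof.
elim: B => [|[|y u] B IH] /=; first by rewrite big1.
  by rewrite add0n -IH; apply: eq_bigr.
rewrite big_split /= IH; congr (_ + _)%N.
rewrite (bigD1 y)//= eqxx big1// => x /negbTE xy.
by rewrite (inj_eq Some_inj) eq_sym xy.
Qed.

Definition child_bad x (B : seq (seq 'I_d)) : seq (seq 'I_d) :=
  [seq behead u | u <- B & ohead u == Some x].

(** The entry [[::]] is handed to no child. This strict drop pays for visiting one vertex and makes
    the traversal linear. *)
Lemma sum_size_child_bad B : [::] \in B ->
  (\sum_(x <- enum 'I_d) size (child_bad x B) < size B)%N.
Proof.
move=> B0; under eq_bigr => x _ do rewrite size_map size_filter.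
rewrite big_enum sum_count_children -(count_predC (fun u => u != [::]) B).
rewrite -[ltnLHS]addn0 ltn_add2l -has_count; apply/hasP.
by exists [::].
Qed.

Lemma mem_child_bad x u B : (x :: u \in B) -> u \in child_bad x B.
Proof.
by move=> xu; apply/mapP; exists (x :: u); rewrite // mem_filter /= eqxx.
Qed.

(** As [c] has word length 1, truncating at 2 keeps just the local permutation of [t] at its
    root. *)
Lemma bact_at_children (t : portrait d) : bact (at_ c t) =
  bact (trunc 2 (at_ c t)) * \prod_(x <- enum 'I_d)
    bact (at_ (a0, [:: x0; x]) (sec t [:: x])).
Proof.
pose ps := [seq (a0, [:: x0; x]) | x <- enum 'I_d].
pose T (p : vertex k d) := sec t (drop 1 p.2).
rewrite [LHS](bact_trunc_asm 2); congr (_ * _).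
have -> : \prod_(x <- enum 'I_d) bact (at_ (a0, [:: x0; x]) (sec t [:: x])) =
    \prod_(p <- ps) bact (at_ p (T p)).
  by rewrite [RHS]big_map.
rewrite (@prod_at _ _ 2); first last.
- by apply/allP => p /mapP[x _ ->].
- by rewrite map_inj_uniq ?enum_uniq// => x y [].
apply: (@bij_ext_level _ _ 2) => -[a [|y [|x []]]]// xi _.
rewrite !bact_asm//; congr (bd_cat _ (ract _ xi)); apply/funext => v.
rewrite /sec /at_ /asm /=; case: ifP => [/eqP[-> ->]|yc].
  by rewrite map_f ?mem_enum.
case: ifP => // /mapP[z _ [e1 e2 _]].
by rewrite e1 e2 eqxx in yc.
Qed.

(* Depth-first traversal of the finite tree of nontrivial sections. *)
Lemma V_reducible_at : exists A B, forall (bad : seq (seq 'I_d)) t, portrait_in D t ->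
  (forall u, u \notin bad -> sec t u = @pid d) ->
  V_reducible (rho (bact (at_ c t))) (A * size bad + B).
Proof.
have [e eP] := choice zoom_child.
have [ys [ysP ysT]] := @trunc_finite k d D 2.
have [C CP] : exists C, forall y, y \in ys -> V_reducible (rho y) C /\ (size (rho y) <= C)%N.
  by apply: V_reducible_HT_seq => y /ysP[s _ ->]; exact: trunc_HT.
have [E EP] : exists E, forall x, V_reducible (rho (e x)) E /\ (size (rho (e x)) <= E)%N.
  have [|E EP] := @V_reducible_HT_seq [seq e x | x <- enum 'I_d].
    by move=> v /mapP[x _ ->]; exact: (eP x).1.
  by exists E => x; apply: EP; apply: map_f; rewrite mem_enum.
have [B BP] : exists B, V_reducible (rho 1) B.
  by apply: V_reducible_HT; have [] := HT_subgroup.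
(* [c1] pays for splitting a section into its truncation and [d] child sections, [c2] for
   conjugating one child section back to [c]. The coefficient below is the full cost of one vertex,
   including the constant [B] of its [d] recursive calls. *)
pose c1 := delta (L + (L + d * L)); pose c2 := delta (L + (E + L + E)).
exists (c1 + C + d * (c2 + E + B + E))%N, B => bad.
set A := (c1 + C + _)%N.
have [n] := ubnP (size bad); elim: n bad => // n IH bad badn t tD tbad.
case: (pselect (t = @pid d)) => [->|t1].
  by rewrite at_pid; apply: V_reducible_leq BP; exact: leq_addl.
have bad0 : [::] \in bad by apply: contrapT => /negP /tbad.
have childK x : Kn 0 (bact (at_ (a0, [:: x0; x]) (sec t [:: x]))).
  by apply: K_at; exact: portrait_in_sec.
have cK x : Kn 0 (bact (at_ c (sec t [:: x]))) by apply: K_at; exact: portrait_in_sec.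
have truncP : bact (trunc 2 (at_ c t)) \in ys.
  apply: ysT; apply: portraits_in_asm => p _; case: ifP => // _; exact: portrait_in_pid.
have truncK : Kn 0 (bact (trunc 2 (at_ c t))).
  by apply: K_trunc; apply: portraits_in_asm => p _; case: ifP => // _; exact: portrait_in_pid.
have atK : Kn 0 (bact (at_ c t)) by exact: K_at.
pose W x := rho (bact (at_ (a0, [:: x0; x]) (sec t [:: x]))).
have evW : evA (flatten (map W (enum 'I_d))) = \prod_(x <- enum 'I_d)
    bact (at_ (a0, [:: x0; x]) (sec t [:: x])).
  elim: (enum _) => [|x l IHl]; first by rewrite big_nil word_eval_nil.
  by rewrite big_cons /= word_eval_cat IHl /W (rho_K (childK x)).
have sizeW : (size (flatten (map W (enum 'I_d))) <= d * L)%N.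
  rewrite -[X in (_ <= X * _)%N](size_enum_ord d).
  elim: (enum _) => [|x l IHl] //=; rewrite size_cat mulSn leq_add//.
  exact: rhoK.
have step1 : homotopic c1 (rho (bact (at_ c t)))
    (rho (bact (trunc 2 (at_ c t))) ++ flatten (map W (enum 'I_d))).
  apply: dehn.
    by rewrite size_cat leq_add// ?leq_add// rhoK.
  by rewrite word_eval_cat evW (rho_K atK) (rho_K truncK) -bact_at_children.
have niceW x : V_reducible (W x) (c2 + (E + (A * size (child_bad x bad) + B) + E)).
  apply: (@V_reducible_homotopic _ (rho (e x) ++ rho (bact (at_ c (sec t [:: x]))) ++
      word_inv (rho (e x)))); last first.
    rewrite catA; apply: V_reducible_cat; last by apply: V_reducible_inv; exact: (EP x).1.
    apply: V_reducible_cat; first exact: (EP x).1.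
    apply: IH => [||u ux]; [|exact: portrait_in_sec|]; last first.
      by rewrite sec_sec tbad//; apply: contra ux => /mem_child_bad.
    rewrite size_map size_filter; apply: (@leq_trans (size bad)); last first.
      by rewrite -ltnS.
    rewrite -(count_predC (fun u => ohead u == Some x) bad).
    rewrite -[X in (X < _)%N]addn0 ltn_add2l -has_count.
    by apply/hasP; exists [::].
  apply: dehn.
    have := rhoK (childK x); have := rhoK (cK x); have := (EP x).2.
    rewrite !size_cat size_word_inv /W; lia.
  rewrite !word_eval_cat word_eval_inv (rho_K (childK x)) (rho_K (cK x)).
  by rewrite (rho_HT (eP x).1) (at_conj _ (eP x).2) mulgA.
have := V_reducible_homotopic step1 (V_reducible_cat (CP _ truncP).1 (V_reducible_flatten (enum 'I_d) niceW)).
apply: V_reducible_leq; rewrite big_split /= big_split /= big_split /= big_split /=.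
rewrite -big_distrr /= !big_const_seq !count_predT !iter_addn_0 size_enum_ord.
have := sum_size_child_bad bad0; set s := (\sum_(_ <- _) _)%N => sbad.
(* Since [s < size bad], one more summand [A] is available: the cost of the present vertex. *)
apply: (@leq_trans (A * s.+1 + B)); last by rewrite leq_add2r leq_mul2l sbad orbT.
rewrite mulnS /A; lia.
Qed.

(** From the cone [c] to the whole tree: after truncation at 1, the sections at the [k * d] words of
    length 1 are moved to [c] by [zoom_vertex]. *)
Lemma V_reducible_K : exists A B, forall f bad, Kn 0 f -> bad_in f bad ->
  V_reducible (rho f) (A * size bad + B).
Proof.
have [A [B AB]] := V_reducible_at.
pose ps := [seq (a, [:: x]) | a <- enum 'I_k, x <- enum 'I_d].
have ps1 p : (p \in ps) = (size p.2 == 1%N).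
  apply/allpairsP/eqP => [[[a x] /= [_ _ ->]]//|].
  by case: p => a [|x []]//= _; exists (a, x); rewrite !mem_enum.
have [z zP] : exists z : vertex k d -> bd,
    forall p, p \in ps -> HT (z p) /\ replaces (z p) c p.
  have /choice[z zP] : forall p : vertex k d, exists z,
      p \in ps -> HT z /\ replaces z c p.
    move=> p; case pP : (p \in ps); last by exists 1.
    by have [|z ? ?] := @zoom_vertex p; [apply/eqP; rewrite -ps1|exists z].
  by exists z.
have [ys [ysP ysT]] := @trunc_finite k d D 1.
have [C CP] : exists C, forall y, y \in ys -> V_reducible (rho y) C /\ (size (rho y) <= C)%N.
  by apply: V_reducible_HT_seq => y /ysP[s _ ->]; exact: trunc_HT.
have [E EP] : exists E, forall p, p \in ps -> V_reducible (rho (z p)) E /\ (size (rho (z p)) <= E)%N.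
  have [|E EP] := @V_reducible_HT_seq [seq z p | p <- ps].
    by move=> v /mapP[p /zP[? _] ->].
  by exists E => p pps; apply: EP; exact: map_f.
pose P := size ps; pose c1 := delta (L + (L + P * L)).
pose c2 := delta (L + (E + L + E)).
exists (P * A)%N, (c1 + C + P * (c2 + E + B + E))%N => f bad [s [sD _ ->]] sbad.
pose T (p : vertex k d) := sec (s p.1) p.2.
have TD p : portrait_in D (T p) by apply: portrait_in_sec; exact: sD.
have childK p : Kn 0 (bact (at_ p (T p))) by exact: K_at.
have cK p : Kn 0 (bact (at_ c (T p))) by exact: K_at.
have truncP : bact (trunc 1 s) \in ys by exact: ysT.
have truncK : Kn 0 (bact (trunc 1 s)) by exact: K_trunc.
have sK : Kn 0 (bact s) by exists s.
have sE : bact s = bact (trunc 1 s) * \prod_(p <- ps) bact (at_ p (T p)).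
  rewrite [LHS](bact_trunc_asm 1%N); congr (_ * _); rewrite (@prod_at _ _ 1%N).
  - apply: (@bij_ext_level _ _ 1%N) => p xi p1; rewrite !bact_asm//.
    by rewrite ps1 p1.
  - by apply: allpairs_uniq; rewrite ?enum_uniq// => -[? ?] [? ?] _ _ [-> ->].
  - by apply/allP => p; rewrite ps1.
pose W (p : vertex k d) := rho (bact (at_ p (T p))).
have evW : evA (flatten (map W ps)) = \prod_(p <- ps) bact (at_ p (T p)).
  elim: (ps) => [|p l IHl]; first by rewrite big_nil word_eval_nil.
  by rewrite big_cons /= word_eval_cat IHl /W (rho_K (childK p)).
have sizeW : (size (flatten (map W ps)) <= P * L)%N.
  rewrite /P; elim: (ps) => [|p l IHl] //=; rewrite size_cat mulSn leq_add//.
  exact: rhoK.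
have step1 : homotopic c1 (rho (bact s))
    (rho (bact (trunc 1 s)) ++ flatten (map W ps)).
  apply: dehn; first by rewrite size_cat leq_add// ?leq_add// rhoK.
  by rewrite word_eval_cat evW (rho_K sK) (rho_K truncK) -sE.
have niceW p : p \in ps -> V_reducible (W p) (c2 + (E + (A * size bad + B) + E)).
  move=> pps; apply: (@V_reducible_homotopic _ (rho (z p) ++ rho (bact (at_ c (T p))) ++
      word_inv (rho (z p)))); last first.
    rewrite catA; apply: V_reducible_cat; last by apply: V_reducible_inv; exact: (EP p pps).1.
    apply: V_reducible_cat; first exact: (EP p pps).1.
    (* Every [p] uses the full list [bad], with first letters dropped, instead of its part below
       [p]; this loses only the constant factor [P]. *)
    rewrite -(size_map (fun q => drop 1 q.2) bad); apply: AB => // u ux.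
    rewrite /T sec_sec; apply: (@bad_bact _ _ hd s bad (p.1, p.2 ++ u)) => //.
    move: pps; rewrite ps1 => p1; apply: contra ux => pu.
    apply/mapP; exists (p.1, p.2 ++ u) => //.
    by rewrite /= drop_size_cat//; exact/eqP.
  apply: dehn.
    have := rhoK (childK p); have := rhoK (cK p); have := (EP p pps).2.
    rewrite !size_cat size_word_inv /W; lia.
  rewrite !word_eval_cat word_eval_inv (rho_K (childK p)) (rho_K (cK p)).
  by rewrite (rho_HT (zP p pps).1) (at_conj _ (zP p pps).2) mulgA.
have niceWs : V_reducible (flatten (map W ps)) (P * (c2 + (E + (A * size bad + B) + E))).
  rewrite /P; move: (fun p pps => niceW p pps); elim: (ps) => [_|p l IHl h].
    exact: V_reducible_nil.
  rewrite /= mulSn; apply: V_reducible_cat; first by apply: h; rewrite mem_head.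
  by apply: IHl => q ql; apply: h; rewrite inE ql orbT.
apply: V_reducible_leq (V_reducible_homotopic step1 (V_reducible_cat (CP _ truncP).1 niceWs)).
rewrite !mulnDr mulnA; lia.
Qed.

(** The linear term pays for rewriting [w] as a word of linear length in V, the product for filling
    that word in V and each relator used there in G. *)
Lemma filling_relation : exists C, forall n (w : word S), relation_le iA n w ->
  filling iA m w (C * n.+1 + deltaV (C * n.+1) * delta (LV * mV)).
Proof.
have [vs [C1 [vsH pushP]]] := push_K; have [A [B AB]] := V_reducible_K.
have [C2 C2P] := V_reducible_HT_seq vsH.
have [bv bvP] : exists N, forall v, v \in vs ->
    exists bad, (size bad <= N)%N /\ bad_in v bad.
  apply: (@seq_bound bd (fun v N => exists bad, (size bad <= N)%N /\ bad_in v bad)).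
    move=> v a b ab [bad [ba vb]]; exists bad; split=> //; exact: leq_trans ab.
  by move=> v /vsH/(HT_bad hd)[bad vb]; exists (size bad), bad.
pose C := (C1 + C2 + delta (L + L) + A * bv + B)%N.
exists C => n w [wn w1].
have niceww : V_reducible w (C * n.+1).
  have [l [f [lvs lw fK wE]]] := pushP w.
  (* As [w] represents 1, the K-part is inverse to a product of [size w] elements of the finite list
     [vs]; by [bad_mul] this gives [f^-1] linearly many bad vertices. *)
  have lf : \prod_(v <- l) v = f^-1.
    have := homotopic_eval wE; rewrite w1 word_eval_cat (rho_K fK).
    have -> : evA (flatten (map rho l)) = \prod_(v <- l) v.
      elim: (l) lvs => [|v l' IHl] lvs; first by rewrite big_nil word_eval_nil.
      rewrite big_cons /= word_eval_cat rho_HT; last by apply/vsH/lvs/mem_head.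
      by rewrite IHl// => u ul; apply: lvs; rewrite inE ul orbT.
    by move=> e; rewrite -[LHS](mulgK f) -e mul1g.
  have [bad sbad fbad] : exists2 bad, (size bad <= bv * size l)%N &
      bad_in f^-1 bad.
    rewrite -lf; elim: (l) lvs => [|v l' IHl] lvs.
      by exists [::] => // p _; exists p; rewrite big_nil.
    have [|bad' sbad' bad'P] := IHl.
      by move=> u ul; apply: lvs; rewrite inE ul orbT.
    have [bad [sb vb]] := bvP v (lvs _ (mem_head _ _)).
    have [E sE EP] := bad_mul hd vb bad'P.
    by exists E; rewrite ?big_cons// sE mulnS leq_add.
  (* Bad vertices are counted for [f^-1], not for [f], hence the inverse word. *)
  have nf : V_reducible (rho f) (delta (L + L) + (A * size bad + B)).
    apply: (@V_reducible_homotopic _ (word_inv (rho f^-1))).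
      apply: dehn; last by rewrite word_eval_inv !(@rho_K 0)// ?invgK//; exact: KV.
      by rewrite size_word_inv leq_add// rhoK//; exact: KV.
    by apply: V_reducible_inv; apply: AB => //; exact: KV.
  have nl : V_reducible (flatten (map rho l)) (C2 * size l).
    elim: (l) lvs => [|v l' IHl] lvs; first by rewrite muln0; exact: V_reducible_nil.
    rewrite mulnS; apply: V_reducible_cat; first by apply: (C2P _ _).1; exact/lvs/mem_head.
    by apply: IHl => u ul; apply: lvs; rewrite inE ul orbT.
  apply: V_reducible_leq (V_reducible_homotopic wE (V_reducible_cat nl nf)).
  rewrite /C lw; apply: (@leq_trans (C * (size w).+1)); last first.
    by rewrite leq_mul2l ltnS wn orbT.
  have : (A * size bad <= A * bv * size w)%N.
    by rewrite -mulnA leq_mul2l -lw sbad orbT.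
  rewrite /C; nia.
have [u us wu] := niceww.
have u1 : evV u = 1 by rewrite -ev_subst -(homotopic_eval wu).
apply: filling_homotopic wu _; apply: filling_subst.
exact: (filling_dehn SVpres SVdehn).
Qed.

End Comparison.

Theorem theorem1p2 (k d : nat) (D : {group 'S_d}) (hk : (1 <= k)%N)
    (hd : (2 <= d)%N) (delta_AAutD delta_V : nat -> nat)
    (hAAutD : is_dehn_function (@AAutD_val k d D) delta_AAutD)
    (hV : is_dehn_function (@V_val k d) delta_V) :
  asymp_le delta_AAutD delta_V.
Proof.
have [S [m [Sc Sp Sd]]] := hAAutD; have [SV [mV [SVc SVp SVd]]] := hV.
(* [rho f] is a shortest word for [f], so every bound on word length passes to it. *)
have /choice[rho rhoP] : forall f : bij (boundary k d), exists u : word S,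
    AAutD D f -> word_eval (@AAutD_val k d D) u = f /\
      forall w : word S, word_eval (@AAutD_val k d D) w = f ->
        (size u <= size w)%N.
  move=> f; case: (pselect (AAutD D f)) => [fA|?]; last by exists [::].
  have ex : exists n, `[< exists2 w : word S, size w = n &
      word_eval (@AAutD_val k d D) w = f >].
    have [w wE] := AA_word Sp.1 fA; exists (size w); apply/asboolP; by exists w.
  case: (ex_minnP ex) => n /asboolP[w wn wE] nmin; exists w => _; split=> // w' wE'.
  by rewrite wn; apply: nmin; apply/asboolP; exists w'.
have rhoE f : AAutD D f -> word_eval (@AAutD_val k d D) (rho f) = f.
  by move=> /rhoP[].
have [L LP] := K_bounded hd Sc Sp.1.
have rhoK f : K D 0 f -> (size (rho f) <= L)%N.
  move=> fK; have [w wL wE] := LP f fK.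
  by apply: leq_trans wL; apply: (rhoP f _).2 => //; exact: AAK fK.
have [LV rhoV] : exists LV, forall x, SV x -> (size (rho (V_val x)) <= LV)%N.
  (* All sets are open in V, so the level sets of the length of [rho] form an open cover and only
     finitely many lengths occur on [SV]. *)
  have [|l lP] := @compact_subcover (V_group k d) nat SV
      (fun n => [set x | size (rho (V_val x)) = n]) SVc.
    move=> x _; exists (size (rho (V_val x))).
    by apply: open_nbhs_nbhs; split=> //; exact: discrete_open.
  exists (\max_(n <- l) n)%N => x /lP[n nl /= ->].
  exact: (@leq_bigmax_seq _ _ xpredT id).
have [C CP] := filling_relation hk hd Sc Sp Sd SVp SVd rhoE rhoK rhoV.
pose M := delta_AAutD (LV * mV)%N.
(* Argument 0 is absorbed by the summand [delta_AAutD 0]; for positive arguments, doubling [C]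
   absorbs the shift in [C * n.+2]. *)
exists (C.*2 + M + delta_AAutD 0)%N => -[|n].
  by rewrite !muln0; lia.
apply: (@leq_trans (C * n.+2 + delta_V (C * n.+2) * M)%N).
  by apply: (dehn_le Sd) => w wn; exact: CP.
set c := (C.*2 + M + _)%N.
have Cn : (C * n.+2 <= c * n.+1)%N by rewrite /c; nia.
have dn := dehn_mono SVd Cn.
have : (delta_V (C * n.+2) * M <= c * delta_V (c * n.+1))%N.
  by rewrite mulnC leq_mul// /c; lia.
lia.
Qed.
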